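(* Let $\mathbb{A}:D(\mathbb{A})\subset\mathbb{X}\to\mathbb{X}$ be the generator of a $C_0$-semigroup $\{e^{t\mathbb{A}}\}_{t\ge 0}$ of bounded linear operators on a Banach space $\mathbb{X}$, and let $\mathbb{V}\subset\mathbb{X}$ be a Banach space such that $(V_1)$–$(V_3)$ hold. Suppose $\mathbb{A}$ has property $(UHBD)$ with respect to $\mathbb{V}$, with constants $\mu_0>0$, $M>0$, with the function $m\equiv1$, and decompositions $\mathbb{X}=\mathbb{X}_\mu^-\oplus\mathbb{X}_\mu^+$, $\mu>\mu_0$. Assume moreover that $$K_\mu^-\le(1-\mu_0/\mu)^{-1},\qquad K_\mu^+\le(1-\mu_0/\mu)^{-1}\qquad\text{for all }\mu>\mu_0,$$ where $K_\mu^+:=\|\mathbb{P}_\mu^+\|_{\mathcal{L}(\mathbb{X},\mathbb{V})}$, $K_\mu^-:=\|\mathbb{P}_\mu^-\|_{\mathcal{L}(\mathbb{X},\mathbb{X})}$ and $\mathbb{P}_\mu^{\pm}:\mathbb{X}\to\mathbb{X}_\mu^{\pm}$ are the projections associated with the decomposition. Let $\mathbb{F}:\mathbb{V}\to\mathbb{X}$ be Lipschitz with constant $L>0$. Then the period $T>0$ of any nonstationary (nonconstant) periodic mild solution $z:\mathbb{R}\to\mathbb{V}$ of $\dot z=\mathbb{A}z+\mathbb{F}(z)$ satisfies $$T\ge\frac{1}{L\left(1+\sqrt{M(1+\mu_0/L)}\right)^2}.$$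
   Context: Conditions on the Banach space $(\mathbb{V},\|\cdot\|_{\mathbb{V}})$: $(V_1)$ $D(\mathbb{A})\subset\mathbb{V}\subset\mathbb{X}$; $(V_2)$ $\mathbb{V}$ is embedded continuously into $\mathbb{X}$; $(V_3)$ $e^{t\mathbb{A}}(\mathbb{X})\subset\mathbb{V}$ for all $t>0$, and the family $\{e^{t\mathbb{A}}|_{\mathbb{V}}:\mathbb{V}\to\mathbb{V}\}_{t\ge0}$ is a $C_0$-semigroup of bounded linear operators on $\mathbb{V}$. Property $(UHBD)$ (uniformly half-bounded decomposition): there exist $\mu_0\ge0$, $M>0$ and a continuous $m:(0,+\infty)\to(0,+\infty)$ such that for any $\mu>\mu_0$ there is a decomposition $\mathbb{X}=\mathbb{X}_\mu^-\oplus\mathbb{X}_\mu^+$ into closed subspaces with: $(D_{\mu,+})$ $\mathbb{X}_\mu^+\subset D(\mathbb{A})$, $\mathbb{A}\mathbb{X}_\mu^+\subset\mathbb{X}_\mu^+$ and $\|\mathbb{A}w\|_{\mathbb{V}}\le\mu M\|w\|_{\mathbb{V}}$ for all $w\in\mathbb{X}_\mu^+$; $(D_{\mu,-})$ $\mathbb{A}(\mathbb{X}_\mu^-\cap D(\mathbb{A}))\subset\mathbb{X}_\mu^-$; $\|e^{t\mathbb{A}}w\|_{\mathbb{X}}\le e^{-\mu t}\|w\|_{\mathbb{X}}$ and $\|e^{t\mathbb{A}}w\|_{\mathbb{V}}\le m(t)e^{-\mu t}\|w\|_{\mathbb{X}}$ for all $w\in\mathbb{X}_\mu^-$, $t>0$;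 and $\|e^{t\mathbb{A}}w\|_{\mathbb{V}}\le e^{-\mu t}\|w\|_{\mathbb{V}}$ for all $w\in\mathbb{X}_\mu^-\cap\mathbb{V}$, $t>0$; $(D_{\mu,0})$ $\int_0^t m(s)e^{-\mu s}\,ds<+\infty$ for all $t>0$. Lipschitz with constant $L$ means $\|\mathbb{F}(z_1)-\mathbb{F}(z_2)\|_{\mathbb{X}}\le L\|z_1-z_2\|_{\mathbb{V}}$ for all $z_1,z_2\in\mathbb{V}$. A continuous $z:(T_1,T_2)\to\mathbb{V}$ is a mild solution of $\dot z=\mathbb{A}z+\mathbb{F}(z)$ if for all $t_0<t$ in $(T_1,T_2)$, $z(t)=e^{(t-t_0)\mathbb{A}}z(t_0)+\int_{t_0}^t e^{(t-s)\mathbb{A}}\mathbb{F}(z(s))\,ds$. *)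

(* Defs.v *)
(* Banach spaces are [CompleteNormedModule R_AbsRing].  A Banach space V
   contained in X (as a set, with its own norm) is a Banach space V together
   with an injective linear map [iota : V -> X]; "x belongs to V" then reads
   [exists v, iota v = x].  An unbounded operator is a pair [D : X -> Prop],
   [A : X -> X], the values of [A] outside [D] being irrelevant. *)

From Stdlib Require Import Reals.
From Coquelicot Require Import Coquelicot.

Open Scope R_scope.

(* Only the values [S t] with [0 <= t] matter. *)
Record C0_semigroup {E : CompleteNormedModule R_AbsRing} (S : R -> E -> E)
  : Prop := {
  semigroup_linear : forall t, 0 <= t -> is_linear (S t);
  semigroup_0 : forall x, S 0 x = x;
  semigroup_plus : forall s t x, 0 <= s -> 0 <= t -> S (s + t) x = S s (S t x);
  semigroup_cont : forall x, filterlim (fun t => S t x) (at_right 0) (locally x)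
}.

Record is_generator {E : CompleteNormedModule R_AbsRing}
    (S : R -> E -> E) (D : E -> Prop) (A : E -> E) : Prop := {
  generator_dom : forall x, D x <->
    exists y, filterlim (fun h => scal (/ h) (minus (S h x) x))
                (at_right 0) (locally y);
  generator_val : forall x, D x ->
    filterlim (fun h => scal (/ h) (minus (S h x) x))
      (at_right 0) (locally (A x))
}.

Definition in_V_norm_le {X V : CompleteNormedModule R_AbsRing}
    (iota : V -> X) (x : X) (r : R) : Prop :=
  exists v : V, iota v = x /\ norm v <= r.

(* The continuity of the embedding is part of [is_linear]. *)
Record V_conditions {X V : CompleteNormedModule R_AbsRing}
    (S : R -> X -> X) (D : X -> Prop) (iota : V -> X) : Prop := {
  V_inj : forall v w, iota v = iota w -> v = w;
  V_dom : forall x, D x -> exists v, iota v = x;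
  V_cont : is_linear iota;
  V_smoothing : forall t x, 0 < t -> exists v, iota v = S t x;
  V_semigroup : exists SV : R -> V -> V,
    (forall t v, 0 <= t -> iota (SV t v) = S t (iota v)) /\ C0_semigroup SV
}.

Record closed_subspace {E : CompleteNormedModule R_AbsRing} (P : E -> Prop)
  : Prop := {
  subspace_zero : P zero;
  subspace_plus : forall x y, P x -> P y -> P (plus x y);
  subspace_scal : forall (k : R) x, P x -> P (scal k x);
  subspace_closed : closed P
}.

Record closed_direct_sum {E : CompleteNormedModule R_AbsRing}
    (Em Ep : E -> Prop) : Prop := {
  direct_sum_m : closed_subspace Em;
  direct_sum_p : closed_subspace Ep;
  direct_sum_span : forall x, exists a b, Em a /\ Ep b /\ x = plus a b;
  direct_sum_disjoint : forall x, Em x -> Ep x -> x = zero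
}.

Record D_plus {X V : CompleteNormedModule R_AbsRing}
    (D : X -> Prop) (A : X -> X) (iota : V -> X) (M mu : R)
    (Xp : X -> Prop) : Prop := {
  D_plus_dom : forall w, Xp w -> D w;
  D_plus_inv : forall w, Xp w -> Xp (A w);
  D_plus_bound : forall w : V, Xp (iota w) ->
    in_V_norm_le iota (A (iota w)) (mu * M * norm w)
}.

Record D_minus {X V : CompleteNormedModule R_AbsRing}
    (S : R -> X -> X) (D : X -> Prop) (A : X -> X) (iota : V -> X)
    (m : R -> R) (mu : R) (Xm : X -> Prop) : Prop := {
  D_minus_inv : forall w, Xm w -> D w -> Xm (A w);
  D_minus_XX : forall t w, 0 < t -> Xm w ->
    norm (S t w) <= exp (- mu * t) * norm w;
  D_minus_XV : forall t w, 0 < t -> Xm w ->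
    in_V_norm_le iota (S t w) (m t * exp (- mu * t) * norm w);
  D_minus_VV : forall t (w : V), 0 < t -> Xm (iota w) ->
    in_V_norm_le iota (S t (iota w)) (exp (- mu * t) * norm w)
}.

(* The integral is improper at 0, where m may blow up. *)
Definition D_zero (m : R -> R) (mu : R) : Prop :=
  forall t, 0 < t ->
    ex_RInt_gen (fun s => m s * exp (- mu * s)) (at_right 0) (at_point t).

(* Uniformly half-bounded decomposition, with its constants mu0, M, its
   function m and its decompositions X = Xm mu (+) Xp mu made explicit. *)
Record UHBD {X V : CompleteNormedModule R_AbsRing}
    (S : R -> X -> X) (D : X -> Prop) (A : X -> X) (iota : V -> X)
    (mu0 M : R) (m : R -> R) (Xm Xp : R -> X -> Prop) : Prop := {
  UHBD_mu0 : 0 <= mu0;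
  UHBD_M : 0 < M;
  UHBD_m_pos : forall t, 0 < t -> 0 < m t;
  UHBD_m_cont : forall t, 0 < t -> continuous m t;
  UHBD_sum : forall mu, mu0 < mu -> closed_direct_sum (Xm mu) (Xp mu);
  UHBD_plus : forall mu, mu0 < mu -> D_plus D A iota M mu (Xp mu);
  UHBD_minus : forall mu, mu0 < mu -> D_minus S D A iota m mu (Xm mu);
  UHBD_zero : forall mu, mu0 < mu -> D_zero m mu
}.

(* The projections along X = Xm (+) Xp.  Since Xp lies in the domain of A, hence in V,
   the projection onto Xp is recorded as a map into V; this is the map whose
   norm in L(X,V) is taken. *)
Definition are_projections {X V : CompleteNormedModule R_AbsRing}
    (iota : V -> X) (Xm Xp : X -> Prop) (Pm : X -> X) (Pp : X -> V) : Prop :=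
  forall x, Xm (Pm x) /\ Xp (iota (Pp x)) /\ x = plus (Pm x) (iota (Pp x)).

(* Operator norm, with value [p_infty] for an unbounded operator. *)
Definition op_norm {E G : CompleteNormedModule R_AbsRing} (f : E -> G) : Rbar :=
  Lub_Rbar (fun r => exists x, norm x <= 1 /\ r = norm (f x)).

Definition lipschitz {X V : CompleteNormedModule R_AbsRing}
    (F : V -> X) (L : R) : Prop :=
  forall z1 z2, norm (minus (F z1) (F z2)) <= L * norm (minus z1 z2).

(* Mild solutions on (T1,T2), with T1, T2 possibly infinite; the integral is
   that of a continuous X-valued function. *)
Record mild_solution {X V : CompleteNormedModule R_AbsRing}
    (S : R -> X -> X) (iota : V -> X) (F : V -> X)
    (T1 T2 : Rbar) (z : R -> V) : Prop := {
  mild_cont : forall t : R, Rbar_lt T1 t -> Rbar_lt t T2 -> continuous z t;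
  mild_eq : forall t0 t : R, Rbar_lt T1 t0 -> t0 < t -> Rbar_lt t T2 ->
    exists I : X,
      is_RInt (fun s => S (t - s) (F (z s))) t0 t I /\
      iota (z t) = plus (S (t - t0) (iota (z t0))) I
}.

(* Main.v *)
(* Fix mu and split a periodic solution as z = w + v with v in the plus space and w in the
   minus space.  Write K for the common bound on the projections, and Delta and sigma for the
   oscillations of z and v in the norm of V.  Integrating the decay of the semigroup on the
   minus space over one period shows that w oscillates by at most (K L / mu) Delta, so that
   Delta <= sigma / (1 - K L / mu).  On the plus space A is bounded, hence v has a right
   derivative G, whose oscillation is at most mu M sigma + K L Delta.  As v is periodic,
   G has mean zero, so G is bounded by its oscillation and
   sigma <= T (mu M sigma + K L Delta).  Therefore 1 <= T (mu M + K L / (1 - K L / mu)),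
   and it remains to choose mu optimally.

   That the projections commute with the semigroup is not assumed: it is deduced from the
   invariance of the two spaces under A by a right-derivative argument, which needs the local
   boundedness of the semigroup, hence the uniform boundedness principle. *)

Require Import Defs.
From Stdlib Require Import Reals ZArith Lra Lia List Classical IndefiniteDescription.
From Coquelicot Require Import Coquelicot.
Open Scope R_scope.

(** * Linear identities in real vector spaces *)

(** Syntax for proof by reflection: an identity between linear combinations of vectors reduces to
    one equation between real coefficients for each atom. *)
Inductive mexpr : Type :=
| MVar (n : nat)
| MZero
| MPlus (e1 e2 : mexpr)
| MOpp (e : mexpr)
| MScal (k : R) (e : mexpr).

Section ModuleReflection.

Context {E : ModuleSpace R_Ring}.

Fixpoint mexpr_eval (env : list E) (e : mexpr) : E :=
  match e with
  | MVar n => nth n env zero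
  | MZero => zero
  | MPlus e1 e2 => plus (mexpr_eval env e1) (mexpr_eval env e2)
  | MOpp e => opp (mexpr_eval env e)
  | MScal k e => scal k (mexpr_eval env e)
  end.

Fixpoint mexpr_coef (e : mexpr) (i : nat) : R :=
  match e with
  | MVar n => if Nat.eqb n i then 1 else 0
  | MZero => 0
  | MPlus e1 e2 => mexpr_coef e1 i + mexpr_coef e2 i
  | MOpp e => - mexpr_coef e i
  | MScal k e => k * mexpr_coef e i
  end.

Fixpoint lin_comb (env : list E) (c : nat -> R) : E :=
  match env with
  | nil => zero
  | x :: env' => plus (scal (c O) x) (lin_comb env' (fun i => c (S i)))
  end.

(** A finite conjunction rather than a quantified statement, so that computation unfolds it into
    separate goals for [ring] or [field]. *)
Fixpoint coef_eq (n : nat) (c d : nat -> R) : Prop :=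
  match n with
  | O => True
  | S n' => c O = d O /\ coef_eq n' (fun i => c (S i)) (fun i => d (S i))
  end.

Lemma lin_comb_ext (env : list E) (c d : nat -> R) :
  coef_eq (length env) c d -> lin_comb env c = lin_comb env d.
Proof.
  revert c d; induction env as [|x env IH]; intros c d; simpl; auto.
  intros [H0 H1]. rewrite H0. f_equal. now apply IH.
Qed.

Lemma lin_comb_ext_all (env : list E) (c d : nat -> R) :
  (forall i, c i = d i) -> lin_comb env c = lin_comb env d.
Proof.
  revert c d; induction env as [|x env IH]; intros c d H; simpl; auto.
  rewrite H. f_equal. now apply IH.
Qed.

Lemma lin_comb_zero (env : list E) : lin_comb env (fun _ => 0) = zero.
Proof.
  induction env as [|x env IH]; simpl; auto.
  rewrite IH. rewrite (scal_zero_l (K := R_Ring) x : scal 0 x = zero). apply plus_zero_l.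
Qed.

Lemma lin_comb_plus (env : list E) (c d : nat -> R) :
  lin_comb env (fun i => c i + d i) = plus (lin_comb env c) (lin_comb env d).
Proof.
  revert c d; induction env as [|x env IH]; intros c d; simpl.
  - now rewrite plus_zero_l.
  - rewrite (IH (fun i => c (S i))).
    rewrite (scal_distr_r (K := R_Ring) (c O) (d O) x : scal (c O + d O) x = _).
    rewrite <- !plus_assoc. f_equal. rewrite !plus_assoc. f_equal. apply plus_comm.
Qed.

Lemma lin_comb_scal (env : list E) (k : R) (c : nat -> R) :
  lin_comb env (fun i => k * c i) = scal k (lin_comb env c).
Proof.
  revert c; induction env as [|x env IH]; intros c; simpl.
  - now rewrite scal_zero_r.
  - rewrite (IH (fun i => c (S i))).
    rewrite (scal_distr_l (K := R_Ring) k). f_equal. symmetry. apply (scal_assoc (K := R_Ring)).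
Qed.

Lemma lin_comb_var (env : list E) (n : nat) :
  lin_comb env (fun i => if Nat.eqb n i then 1 else 0) = nth n env zero.
Proof.
  revert n; induction env as [|x env IH]; intros n; destruct n as [|n]; simpl; auto.
  - rewrite (lin_comb_zero env), plus_zero_r. apply (scal_one (K := R_Ring)).
  - rewrite (IH n). rewrite (scal_zero_l (K := R_Ring) x : scal 0 x = zero). apply plus_zero_l.
Qed.

Lemma mexpr_eval_lin_comb (env : list E) (e : mexpr) :
  mexpr_eval env e = lin_comb env (mexpr_coef e).
Proof.
  induction e as [n| |e1 IH1 e2 IH2|e IH|k e IH]; simpl.
  - symmetry. apply lin_comb_var.
  - symmetry. apply lin_comb_zero.
  - rewrite IH1, IH2. symmetry. apply lin_comb_plus.
  - rewrite IH. rewrite <- (scal_opp_one (K := R_Ring)).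
    change (opp one : R) with (- (1)).
    rewrite <- lin_comb_scal. apply lin_comb_ext_all. intros i. ring.
  - rewrite IH. symmetry. apply lin_comb_scal.
Qed.

Lemma mexpr_eval_eq (env : list E) (e1 e2 : mexpr) :
  coef_eq (length env) (mexpr_coef e1) (mexpr_coef e2) ->
  mexpr_eval env e1 = mexpr_eval env e2.
Proof.
  intros H. rewrite !mexpr_eval_lin_comb. now apply lin_comb_ext.
Qed.

End ModuleReflection.

Ltac module_mem x l :=
  lazymatch l with
  | nil => constr:(false)
  | x :: _ => constr:(true)
  | _ :: ?l' => module_mem x l'
  end.

Ltac module_atoms l t :=
  lazymatch t with
  | plus ?a ?b => let l1 := module_atoms l a in module_atoms l1 b
  | minus ?a ?b => let l1 := module_atoms l a in module_atoms l1 b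
  | opp ?a => module_atoms l a
  | scal _ ?a => module_atoms l a
  | zero => l
  | _ => let b := module_mem t l in
         lazymatch b with
         | true => l
         | false => constr:(t :: l)
         end
  end.

Ltac module_index x l :=
  lazymatch l with
  | x :: _ => constr:(O)
  | _ :: ?l' => let n := module_index x l' in constr:(S n)
  end.

Ltac module_quote l t :=
  lazymatch t with
  | plus ?a ?b =>
      let e1 := module_quote l a in let e2 := module_quote l b in constr:(MPlus e1 e2)
  | minus ?a ?b =>
      let e1 := module_quote l a in let e2 := module_quote l b in
      constr:(MPlus e1 (MOpp e2))
  | opp ?a => let e := module_quote l a in constr:(MOpp e)
  | scal ?k ?a => let e := module_quote l a in constr:(MScal k e)
  | zero => constr:(MZero)
  | _ => let n := module_index t l in constr:(MVar n)
  end.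

Ltac module_eq_with tac :=
  lazymatch goal with
  | |- @eq ?E ?a ?b =>
      let l1 := module_atoms (@nil E) a in
      let l := module_atoms l1 b in
      let e1 := module_quote l a in
      let e2 := module_quote l b in
      refine (mexpr_eval_eq l e1 e2 _);
      (* The real operations stay folded, in the form that [ring] and [field] recognise. *)
      cbn -[Rplus Rmult Ropp Rminus Rinv Rdiv IZR];
      repeat split; tac
  end.

Ltac module_eq := module_eq_with ltac:(try ring).


(** * Limits, derivatives and integrals in norm form *)

Section NormLimits.

Context {E : CompleteNormedModule R_AbsRing}.

(** The reverse inequality is [norm_scal] applied to [/ k] and [scal k x]. *)
Lemma norm_scal_eq (k : R) (x : E) : norm (scal k x) = Rabs k * norm x.
Proof.
  apply Rle_antisym; [exact (norm_scal k x)|].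
  destruct (Req_dec k 0) as [->|Hk].
  - rewrite Rabs_R0, Rmult_0_l. apply norm_ge_0.
  - assert (H : norm x <= Rabs (/ k) * norm (scal k x)).
    { replace (norm x) with (norm (scal (/ k) (scal k x))); [exact (norm_scal _ _)|].
      f_equal. module_eq_with ltac:(try (field; auto)). }
    apply Rmult_le_compat_l with (r := Rabs k) in H; [|apply Rabs_pos].
    rewrite <- Rmult_assoc, <- Rabs_mult, Rinv_r, Rabs_R1 in H by auto. lra.
Qed.

Lemma norm_plus_le (x y : E) : norm (plus x y) <= norm x + norm y.
Proof. exact (norm_triangle x y). Qed.

Lemma norm_minus_sym (x y : E) : norm (minus x y) = norm (minus y x).
Proof.
  rewrite <- norm_opp. f_equal. module_eq.
Qed.

Lemma norm_minus_le (x y : E) : norm (minus x y) <= norm x + norm y.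
Proof.
  rewrite <- (norm_opp y). exact (norm_triangle x (opp y)).
Qed.

Lemma norm_minus_le_trans (x y z : E) :
  norm (minus x z) <= norm (minus x y) + norm (minus y z).
Proof.
  replace (minus x z) with (plus (minus x y) (minus y z)) by module_eq.
  apply norm_plus_le.
Qed.

Lemma norm_le_minus (x y : E) : norm x <= norm y + norm (minus x y).
Proof.
  replace x with (plus y (minus x y)) at 1 by module_eq.
  apply norm_plus_le.
Qed.

Lemma minus_eq_zero_norm (x y : E) : norm (minus x y) <= 0 -> x = y.
Proof.
  intros H.
  assert (H0 : minus x y = zero).
  { apply (norm_eq_zero (minus x y)). apply Rle_antisym; [exact H|apply norm_ge_0]. }
  replace x with (plus y (minus x y)) by module_eq. rewrite H0. apply plus_zero_r.
Qed.

Lemma norm_minus_self (x : E) : norm (minus x x) = 0.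
Proof.
  transitivity (norm (zero : E)); [f_equal; module_eq|exact norm_zero].
Qed.

Lemma filterlim_norm_iff {T : Type} {F : (T -> Prop) -> Prop} {FF : Filter F}
    (f : T -> E) (y : E) :
  filterlim f F (locally y) <->
  forall eps, 0 < eps -> F (fun t => norm (minus (f t) y) < eps).
Proof.
  split.
  - intros H eps He.
    exact (proj1 (filterlim_locally_ball_norm f y) H (mkposreal eps He)).
  - intros H. apply (proj2 (filterlim_locally_ball_norm f y)).
    intros eps. exact (H eps (cond_pos eps)).
Qed.

Lemma continuous_norm_iff (f : R -> E) (t : R) :
  continuous f t <->
  forall eps, 0 < eps -> exists d, 0 < d /\
    forall s, Rabs (s - t) < d -> norm (minus (f s) (f t)) < eps.
Proof.
  unfold continuous. rewrite filterlim_norm_iff. split.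
  - intros H eps He. destruct (H eps He) as [d Hd].
    exists d. split; [apply cond_pos|]. exact Hd.
  - intros H eps He. destruct (H eps He) as [d [Hd0 Hd]].
    exists (mkposreal d Hd0). exact Hd.
Qed.

Lemma at_right_norm_iff (f : R -> E) (y : E) :
  filterlim f (at_right 0) (locally y) <->
  forall eps, 0 < eps -> exists d, 0 < d /\
    forall h, 0 < h < d -> norm (minus (f h) y) < eps.
Proof.
  rewrite filterlim_norm_iff. split.
  - intros H eps He. destruct (H eps He) as [d Hd].
    exists d. split; [apply cond_pos|]. intros h Hh. apply Hd; [|lra].
    change (Rabs (h - 0) < d). rewrite Rabs_pos_eq; lra.
  - intros H eps He. destruct (H eps He) as [d [Hd0 Hd]].
    exists (mkposreal d Hd0). intros h Hh H0. apply Hd.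
    change (Rabs (h - 0) < d) in Hh. apply Rabs_lt_between in Hh. lra.
Qed.

(** Remainders of first-order expansions to the right of 0. Right derivatives and the generator are
    both handled in this form, which avoids difference quotients. *)
Definition little_o (r : R -> E) : Prop :=
  forall eps, 0 < eps -> exists d, 0 < d /\
    forall h, 0 < h < d -> norm (r h) <= eps * h.

Lemma little_o_ext (r1 r2 : R -> E) :
  (forall h, 0 < h -> r1 h = r2 h) -> little_o r1 -> little_o r2.
Proof.
  intros Heq H eps He. destruct (H eps He) as [d [Hd H']].
  exists d. split; auto. intros h Hh. rewrite <- Heq by lra. auto.
Qed.

Lemma little_o_plus (r1 r2 : R -> E) :
  little_o r1 -> little_o r2 -> little_o (fun h => plus (r1 h) (r2 h)).
Proof.
  intros H1 H2 eps He.
  destruct (H1 (eps / 2)) as [d1 [Hd1 K1]]; [lra|].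
  destruct (H2 (eps / 2)) as [d2 [Hd2 K2]]; [lra|].
  exists (Rmin d1 d2). split; [now apply Rmin_glb_lt|].
  intros h Hh. pose proof (Rmin_l d1 d2). pose proof (Rmin_r d1 d2).
  specialize (K1 h ltac:(lra)). specialize (K2 h ltac:(lra)).
  pose proof (norm_plus_le (r1 h) (r2 h)). lra.
Qed.

Lemma little_o_minus (r1 r2 : R -> E) :
  little_o r1 -> little_o r2 -> little_o (fun h => minus (r1 h) (r2 h)).
Proof.
  intros H1 H2. apply (little_o_plus r1 (fun h => opp (r2 h))); auto.
  intros eps He. destruct (H2 eps He) as [d [Hd K]].
  exists d. split; auto. intros h Hh.
  apply Rle_trans with (2 := K h Hh). right. exact (norm_opp (r2 h)).
Qed.

Lemma little_o_unique (y : E) : little_o (fun h => scal h y) -> y = zero.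
Proof.
  intros H. apply (norm_eq_zero y). apply Rle_antisym; [|apply norm_ge_0].
  apply Rnot_lt_le. intros Hy.
  destruct (H (norm y / 2)) as [d [Hd K]]; [lra|].
  specialize (K (d / 2) ltac:(lra)).
  rewrite norm_scal_eq in K. rewrite Rabs_pos_eq in K by lra. nra.
Qed.

Lemma at_right_little_o (f : R -> E) (y : E) :
  filterlim (fun h => scal (/ h) (f h)) (at_right 0) (locally y) <->
  little_o (fun h => minus (f h) (scal h y)).
Proof.
  assert (Heq : forall h, 0 < h ->
    norm (minus (f h) (scal h y)) = h * norm (minus (scal (/ h) (f h)) y)).
  { intros h Hh.
    transitivity (norm (scal h (minus (scal (/ h) (f h)) y))).
    - f_equal. module_eq_with ltac:(try field; lra).
    - rewrite norm_scal_eq, Rabs_pos_eq by lra. reflexivity. }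
  rewrite at_right_norm_iff. split; intros H eps He.
  - destruct (H eps He) as [d [Hd K]]. exists d. split; auto.
    intros h Hh. rewrite Heq by lra. specialize (K h Hh).
    rewrite (Rmult_comm eps h). apply Rmult_le_compat_l; [lra|exact (Rlt_le _ _ K)].
  - destruct (H (eps / 2)) as [d [Hd K]]; [lra|]. exists d. split; auto.
    intros h Hh. specialize (K h Hh). rewrite Heq in K by lra.
    apply Rle_lt_trans with (eps / 2); [|lra].
    apply Rmult_le_reg_l with h; [lra|]. apply Rle_trans with (1 := K). lra.
Qed.

End NormLimits.

(** * Linear maps and bounded families of maps *)

Section BoundedFamilies.

Context {E G : CompleteNormedModule R_AbsRing}.

(** The map may vary with [h], as [S (t - s - h)] does in [semigroup_commute]; a bound uniform in
    [h] is enough. *)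
Lemma little_o_bounded_family (Th : R -> E -> G) (C d0 : R) (r : R -> E) :
  0 < d0 ->
  (forall h x, 0 < h < d0 -> norm (Th h x) <= C * norm x) ->
  little_o r -> little_o (fun h => Th h (r h)).
Proof.
  intros Hd0 HC H eps He.
  assert (HC1 : 0 < Rabs C + 1) by (pose proof (Rabs_pos C); lra).
  destruct (H (eps / (Rabs C + 1))) as [d [Hd K]]; [now apply Rdiv_lt_0_compat|].
  exists (Rmin d d0). split; [now apply Rmin_glb_lt|].
  intros h Hh. pose proof (Rmin_l d d0). pose proof (Rmin_r d d0).
  specialize (HC h (r h) ltac:(lra)). specialize (K h ltac:(lra)).
  apply Rle_trans with (1 := HC).
  apply Rle_trans with ((Rabs C + 1) * (eps / (Rabs C + 1) * h)).
  - pose proof (norm_ge_0 (r h)). pose proof (Rle_abs C). nra.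
  - right. field. lra.
Qed.

(* Lemmas of Coquelicot, retyped over complete spaces so that
   [rewrite] and [lra] see syntactically equal structures. *)
Lemma linear_plus_eq (l : E -> G) (x y : E) :
  is_linear l -> l (plus x y) = plus (l x) (l y).
Proof. intros Hl. exact (linear_plus l Hl x y). Qed.

Lemma linear_scal_eq (l : E -> G) (k : R) (x : E) :
  is_linear l -> l (scal k x) = scal k (l x).
Proof. intros Hl. exact (linear_scal l Hl k x). Qed.

Lemma linear_bound (l : E -> G) :
  is_linear l -> exists C, 0 < C /\ forall x, norm (l x) <= C * norm x.
Proof. intros Hl. exact (linear_norm l Hl). Qed.

Lemma linear_minus_eq (l : E -> G) (x y : E) :
  is_linear l -> l (minus x y) = minus (l x) (l y).
Proof. intros Hl. exact (linear_minus l x y Hl). Qed.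

Lemma linear_zero_eq (l : E -> G) : is_linear l -> l zero = zero.
Proof. intros Hl. exact (linear_zero l Hl). Qed.

Lemma linear_continuous (l : E -> G) (x : E) : is_linear l -> continuous l x.
Proof. exact (linear_cont l x). Qed.

Lemma little_o_linear (l : E -> G) (r : R -> E) :
  is_linear l -> little_o r -> little_o (fun h => l (r h)).
Proof.
  intros Hl. destruct (linear_bound l Hl) as [C [_ HC]].
  apply (little_o_bounded_family (fun _ => l) C 1); auto; lra.
Qed.

(** A linear map commutes with each Riemann sum, and its continuity carries this to the limit. *)
Lemma is_RInt_linear (l : E -> G) (f : R -> E) (a b : R) (I : E) :
  is_linear l -> is_RInt f a b I -> is_RInt (fun s => l (f s)) a b (l I).
Proof.
  intros Hl H. unfold is_RInt in *.
  apply filterlim_ext with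
    (fun ptd => l (scal (sign (b - a)) (Riemann_sum f ptd))).
  - intros ptd. rewrite (linear_scal l Hl). f_equal.
    apply (SF_cons_ind (fun ptd => l (Riemann_sum f ptd) =
      Riemann_sum (fun s => l (f s)) ptd)); clear ptd.
    + intros x0. apply (linear_zero_eq l Hl).
    + intros h ptd IH. rewrite !Riemann_sum_cons, (linear_plus l Hl), IH.
      rewrite (linear_scal l Hl). reflexivity.
  - apply filterlim_comp with (1 := H). now apply linear_continuous.
Qed.

End BoundedFamilies.

(** * A right-sided mean value inequality *)

Section MeanValue.

(** Let [c] be the supremum of the points where [phi] is at most [phi a]. Continuity puts [c] itself
    among them, and if [c < b] the local hypothesis at [c] produces a larger one. *)
Lemma nonincreasing_local (phi : R -> R) (a b : R) :
  a <= b ->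
  (forall t, a <= t <= b -> continuous phi t) ->
  (forall t, a <= t < b ->
     exists d, 0 < d /\ forall h, 0 < h < d -> phi (t + h) <= phi t) ->
  phi b <= phi a.
Proof.
  intros Hab Hc Hloc.
  set (P := fun t => a <= t <= b /\ phi t <= phi a).
  destruct (completeness P) as [c [Hub Hlub]].
  - exists b. intros t [Ht _]. lra.
  - exists a. split; lra.
  - assert (Hac : a <= c) by (apply Hub; split; lra).
    assert (Hcb : c <= b) by (apply Hlub; intros t [Ht _]; lra).
    assert (Hphic : phi c <= phi a).
    { apply Rnot_lt_le. intros Hlt.
      destruct (proj1 (continuous_norm_iff (E := R_CompleteNormedModule) phi c)
                  (Hc c ltac:(lra)) (phi c - phi a) ltac:(lra)) as [d [Hd K]].
      (* Near [c] the function exceeds [phi a], so [c - d / 2] would be a smaller upper bound. *)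
      assert (Hle : c <= c - d / 2); [|lra].
      apply Hlub. intros t [Ht Hpt].
      assert (Htc : t <= c) by (apply Hub; split; auto).
      apply Rnot_lt_le. intros Htd.
      assert (Hk : Rabs (phi t - phi c) < phi c - phi a).
      { apply K. apply Rabs_lt_between. lra. }
      apply Rabs_lt_between in Hk. lra. }
    destruct (Rlt_le_dec c b) as [Hlt|Hge]; [|replace b with c by lra; auto].
    destruct (Hloc c ltac:(lra)) as [d [Hd K]].
    set (h := Rmin (d / 2) (b - c)).
    assert (Hh : 0 < h) by (apply Rmin_glb_lt; lra).
    pose proof (Rmin_l (d / 2) (b - c)) as Hh1.
    pose proof (Rmin_r (d / 2) (b - c)) as Hh2. fold h in Hh1, Hh2.
    specialize (K h ltac:(lra)).
    assert (c + h <= c); [|lra].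
    apply Hub. split; lra.
Qed.

Context {E : CompleteNormedModule R_AbsRing}.

(** The triangle inequality makes the scalar function [norm (minus (u t) (u a)) - (sigma + e) * t]
    locally nonincreasing to the right; then [e] tends to 0. *)
Lemma right_mean_value (u : R -> E) (sigma a b : R) :
  a <= b ->
  (forall t, a <= t <= b -> continuous u t) ->
  (forall t, a <= t < b -> forall eps, 0 < eps -> exists d, 0 < d /\
     forall h, 0 < h < d -> norm (minus (u (t + h)) (u t)) <= (sigma + eps) * h) ->
  norm (minus (u b) (u a)) <= sigma * (b - a).
Proof.
  intros Hab Hc Hd. apply le_epsilon. intros eps He.
  (* This gives [e * (b - a) <= eps]; the added 1 covers the case [a = b]. *)
  set (e := eps / (b - a + 1)).
  assert (He' : 0 < e) by (apply Rdiv_lt_0_compat; lra).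
  assert (Hphi : norm (minus (u b) (u a)) - (sigma + e) * b <=
                 norm (minus (u a) (u a)) - (sigma + e) * a).
  { apply (nonincreasing_local
             (fun t => norm (minus (u t) (u a)) - (sigma + e) * t) a b Hab).
    - intros t Ht.
      apply (continuous_minus (U := R_UniformSpace) (V := R_NormedModule)).
      + apply (continuous_comp (fun t => minus (u t) (u a)) norm).
        * apply (continuous_minus (V := E)); [now apply Hc|apply continuous_const].
        * exact (filterlim_norm (minus (u t) (u a))).
      + apply (continuous_scal_r (V := R_NormedModule) (sigma + e)).
        apply continuous_id.
    - intros t Ht. destruct (Hd t Ht e He') as [d [Hd0 K]].
      exists d. split; auto. intros h Hh. specialize (K h Hh).
      pose proof (norm_minus_le_trans (u (t + h)) (u t) (u a)). lra. }
  rewrite (norm_minus_self (u a)) in Hphi.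
  assert (e * (b - a) <= eps); [|lra].
  apply Rle_trans with (e * (b - a + 1)); [nra|].
  unfold e. right. field. lra.
Qed.

End MeanValue.

(** * The uniform boundedness principle *)

Section UniformBoundedness.

Context {E G : CompleteNormedModule R_AbsRing}.

Lemma cauchy_norm_limit (u : nat -> E) :
  (forall eps, 0 < eps -> exists N, forall n m, (N <= n)%nat -> (N <= m)%nat ->
     norm (minus (u n) (u m)) < eps) ->
  exists x, forall eps, 0 < eps -> exists N, forall n, (N <= n)%nat ->
     norm (minus (u n) x) < eps.
Proof.
  intros H.
  destruct (proj1 (filterlim_locally_cauchy (F := eventually) u)) as [x Hx].
  - intros eps. destruct (H eps (cond_pos eps)) as [N HN].
    exists (fun n => (N <= n)%nat). split.
    + now exists N.
    + intros n m Hn Hm. apply (norm_compat1 (u n) (u m)). exact (HN m n Hm Hn).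
  - exists x. exact (proj1 (filterlim_norm_iff u x) Hx).
Qed.

(** If no tail were uniformly bounded, one could nest closed balls so that on each ball some [T n]
    of large index is large everywhere. Their common point contradicts the pointwise bound. *)
Lemma eventually_uniformly_bounded (T : nat -> E -> G) :
  (forall n, is_linear (T n)) ->
  (forall x, exists N B, forall n, (N <= n)%nat -> norm (T n x) <= B) ->
  exists N C, forall n x, (N <= n)%nat -> norm (T n x) <= C * norm x.
Proof.
  intros HT Hpt. apply NNPP. intros Hno.
  (* A pair in [E * R] is a ball with its radius. Positivity of the radius is a premise inside the
     existential, so that the choice function is total. *)
  assert (Hstep : forall kp : nat * (E * R), exists p : E * R,
    0 < snd (snd kp) ->
    0 < snd p /\ snd p <= snd (snd kp) / 2 /\
    norm (minus (fst p) (fst (snd kp))) <= snd (snd kp) / 2 /\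
    exists n, (fst kp <= n)%nat /\
      forall y, norm (minus y (fst p)) <= snd p -> INR (fst kp) <= norm (T n y)).
  { intros [k [x r]]; simpl.
    destruct (Rlt_le_dec 0 r) as [Hr|Hr]; [|exists (x, r); lra].
    (* Otherwise every [T n] with [n >= k] is bounded by [k + 1] on the ball of radius [r / 2], and
       by homogeneity has norm at most [4 * (k + 1) / r]. *)
    assert (Hbig : exists y n, norm (minus y x) <= r / 2 /\ (k <= n)%nat /\
                     INR k + 1 < norm (T n y)).
    { apply NNPP. intros Hsmall. apply Hno.
      exists k, (4 * (INR k + 1) / r). intros n xi Hn.
      assert (Hle : forall y, norm (minus y x) <= r / 2 -> norm (T n y) <= INR k + 1).
      { intros y Hy. apply Rnot_lt_le. intros Hlt. apply Hsmall. now exists y, n. }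
      assert (Hscal : forall c, 0 < c -> c * norm xi <= r / 2 ->
                c * norm (T n xi) <= 2 * (INR k + 1)).
      { intros c Hc Hcx.
        assert (H1 := Hle (plus x (scal c xi))).
        assert (H0 := Hle x).
        rewrite norm_minus_self in H0. specialize (H0 ltac:(lra)).
        replace (minus (plus x (scal c xi)) x) with (scal c xi) in H1 by module_eq.
        rewrite norm_scal_eq, Rabs_pos_eq in H1 by lra. specialize (H1 Hcx).
        rewrite linear_plus_eq, linear_scal_eq in H1 by auto.
        pose proof (norm_minus_le (plus (T n x) (scal c (T n xi))) (T n x)) as H2.
        replace (minus (plus (T n x) (scal c (T n xi))) (T n x))
          with (scal c (T n xi)) in H2 by module_eq.
        rewrite norm_scal_eq, Rabs_pos_eq in H2 by lra. lra. }
      pose proof (pos_INR k) as Hk.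
      destruct (Rle_lt_or_eq_dec 0 (norm xi) (norm_ge_0 xi)) as [Hxi|Hxi].
      - assert (H := Hscal (r / 2 / norm xi) ltac:(apply Rdiv_lt_0_compat; lra)).
        assert (E1 : r / 2 / norm xi * norm xi = r / 2) by (field; lra).
        specialize (H ltac:(lra)).
        apply Rmult_le_reg_l with (r / 2 / norm xi); [apply Rdiv_lt_0_compat; lra|].
        apply Rle_trans with (1 := H). right. field. lra.
      (* For [norm xi = 0] the factor [c] is unrestricted; this choice would give
         [3 * (k + 1) <= 2 * (k + 1)]. *)
      - rewrite <- Hxi, Rmult_0_r. apply Rnot_lt_le. intros Hlt.
        assert (H := Hscal (3 * (INR k + 1) / norm (T n xi))
                       ltac:(apply Rdiv_lt_0_compat; lra)).
        rewrite <- Hxi, Rmult_0_r in H. specialize (H ltac:(lra)).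
        assert (E1 : 3 * (INR k + 1) / norm (T n xi) * norm (T n xi) =
                     3 * (INR k + 1)) by (field; lra). lra. }
    destruct Hbig as [y [n [Hy [Hn HTy]]]].
    destruct (linear_bound _ (HT n)) as [C [HC0 HC]].
    assert (HC1 : 0 < / C) by now apply Rinv_0_lt_compat.
    (* Within radius [/ C] the map [T n] varies by at most 1, so its norm stays above [k]. *)
    exists (y, Rmin (r / 2) (/ C)). intros _. simpl.
    split; [apply Rmin_glb_lt; lra|]. split; [apply Rmin_l|]. split; [exact Hy|].
    exists n. split; [exact Hn|]. intros w Hw.
    assert (Hw' := Rle_trans _ _ _ Hw (Rmin_r _ _)).
    apply Rmult_le_compat_l with (r := C) in Hw'; [|lra].
    rewrite Rinv_r in Hw' by lra.
    pose proof (HC (minus w y)) as H1. rewrite (linear_minus_eq (T n) w y) in H1 by auto.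
    pose proof (norm_le_minus (T n y) (T n w)) as H2.
    rewrite norm_minus_sym in H2. lra. }
  destruct (functional_choice _ Hstep) as [f Hf]. clear Hstep.
  set (p := nat_rect (fun _ => (E * R)%type) (zero, 1) (fun k q => f (k, q))).
  assert (Hpos : forall k, 0 < snd (p k)).
  { induction k as [|k IH]; simpl; [lra|]. apply (Hf (k, p k)). exact IH. }
  assert (Hp : forall k, snd (p (S k)) <= snd (p k) / 2 /\
    norm (minus (fst (p (S k))) (fst (p k))) <= snd (p k) / 2 /\
    exists n, (k <= n)%nat /\
      forall y, norm (minus y (fst (p (S k)))) <= snd (p (S k)) -> INR k <= norm (T n y)).
  { intros k. apply (Hf (k, p k) (Hpos k)). }
  assert (Hnest : forall j k,
    norm (minus (fst (p (k + j)%nat)) (fst (p k))) <= snd (p k) - snd (p (k + j)%nat)).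
  { induction j as [|j IH]; intros k.
    - rewrite Nat.add_0_r. rewrite norm_minus_self. lra.
    - rewrite Nat.add_succ_r. destruct (Hp (k + j)%nat) as [H1 [H2 _]].
      pose proof (norm_minus_le_trans (fst (p (S (k + j)))) (fst (p (k + j)%nat)) (fst (p k))).
      specialize (IH k). lra. }
  assert (Hsmall : forall eps, 0 < eps -> exists k, snd (p k) < eps).
  { intros eps He.
    assert (Hgeom : forall k, snd (p k) <= (1 / 2) ^ k).
    { induction k as [|k IH]; [simpl; lra|].
      destruct (Hp k) as [H1 _]. change ((1 / 2) ^ S k) with (1 / 2 * (1 / 2) ^ k). lra. }
    destruct (pow_lt_1_zero (1 / 2) ltac:(rewrite Rabs_pos_eq; lra) eps He) as [k Hk].
    exists k. specialize (Hk k (le_n k)). specialize (Hgeom k).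
    pose proof (Rle_abs ((1 / 2) ^ k)). lra. }
  destruct (cauchy_norm_limit (fun k => fst (p k))) as [x Hx].
  { intros eps He. destruct (Hsmall (eps / 2)) as [N HN]; [lra|].
    exists N. intros n m Hn Hm.
    replace n with (N + (n - N))%nat by lia. replace m with (N + (m - N))%nat by lia.
    pose proof (Hnest (n - N)%nat N). pose proof (Hnest (m - N)%nat N).
    pose proof (Hpos (N + (n - N))%nat). pose proof (Hpos (N + (m - N))%nat).
    pose proof (norm_minus_le_trans (fst (p (N + (n - N))%nat)) (fst (p N))
                  (fst (p (N + (m - N))%nat))) as H3.
    rewrite (norm_minus_sym (fst (p N))) in H3. lra. }
  assert (Hball : forall k, norm (minus x (fst (p k))) <= snd (p k)).
  { intros k. apply le_epsilon. intros eps He. destruct (Hx eps He) as [N HN].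
    specialize (HN (k + N)%nat ltac:(lia)). cbv beta in HN. pose proof (Hnest N k).
    pose proof (Hpos (k + N)%nat).
    pose proof (norm_minus_le_trans x (fst (p (k + N)%nat)) (fst (p k))) as H3.
    rewrite (norm_minus_sym x (fst (p (k + N)%nat))) in H3. lra. }
  destruct (Hpt x) as [N [B HB]].
  destruct (INR_unbounded B) as [N' HN'].
  destruct (Hp (N + N')%nat) as [_ [_ [n [Hn HTn]]]].
  specialize (HTn x (Hball _)). specialize (HB n ltac:(lia)).
  rewrite plus_INR in HTn. pose proof (pos_INR N). lra.
Qed.

End UniformBoundedness.

(** * Strongly continuous semigroups *)

Section Semigroup.

Context {E : CompleteNormedModule R_AbsRing}.
Context (S : R -> E -> E) (HS : C0_semigroup S).

Lemma semigroup_right_cont (x : E) (eps : R) :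
  0 < eps -> exists d, 0 < d /\ forall h, 0 <= h < d -> norm (minus (S h x) x) < eps.
Proof.
  intros He.
  destruct (proj1 (at_right_norm_iff _ _) (semigroup_cont S HS x) eps He) as [d [Hd K]].
  exists d. split; auto. intros h Hh.
  destruct (Rle_lt_or_eq_dec 0 h ltac:(lra)) as [H0|<-].
  - apply K. lra.
  - rewrite (semigroup_0 S HS), norm_minus_self. lra.
Qed.

(** Otherwise there are times [t n] tending to 0 with [S (t n)] of norm above [n]. Right continuity
    at 0 bounds [S (t n) x] eventually for each [x], against the uniform boundedness principle. *)
Lemma semigroup_bounded_near_0 :
  exists d C, 0 < d /\ forall t x, 0 <= t <= d -> norm (S t x) <= C * norm x.
Proof.
  apply NNPP. intros Hno.
  assert (Hbad : forall n : nat, exists t, 0 <= t <= / (INR n + 1) /\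
                   exists x, INR n * norm x < norm (S t x)).
  { intros n. apply NNPP. intros Hn. apply Hno.
    exists (/ (INR n + 1)), (INR n). split.
    - apply Rinv_0_lt_compat. pose proof (pos_INR n). lra.
    - intros t x Ht. apply Rnot_lt_le. intros Hlt. apply Hn. exists t. eauto. }
  destruct (functional_choice _ Hbad) as [t Ht].
  destruct (eventually_uniformly_bounded (fun n => S (t n))) as [N [C HC]].
  - intros n. apply (semigroup_linear S HS). apply Ht.
  - intros x. destruct (semigroup_right_cont x 1) as [d [Hd K]]; [lra|].
    destruct (INR_unbounded (/ d)) as [N HN].
    exists N, (norm x + 1). intros n Hn.
    assert (Htn : 0 <= t n < d).
    { destruct (Ht n) as [[H0 H1] _]. split; auto.
      apply Rle_lt_trans with (1 := H1). rewrite <- (Rinv_inv d).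
      apply Rinv_lt_contravar.
      - apply Rmult_lt_0_compat; [now apply Rinv_0_lt_compat|].
        pose proof (pos_INR n). lra.
      - apply le_INR in Hn. lra. }
    specialize (K _ Htn). pose proof (norm_le_minus (S (t n) x) x). lra.
  - destruct (INR_unbounded C) as [N' HN'].
    destruct (Ht (N + N')%nat) as [_ [x Hx]].
    specialize (HC (N + N')%nat x ltac:(lia)).
    rewrite plus_INR in Hx. pose proof (pos_INR N). pose proof (norm_ge_0 x). nra.
Qed.

(** Time is cut into steps of length [d], each costing a factor [C]; taking [C >= 1] makes the
    powers nondecreasing. *)
Lemma semigroup_bounded (tau : R) :
  exists C, 1 <= C /\ forall t x, 0 <= t <= tau -> norm (S t x) <= C * norm x.
Proof.
  destruct semigroup_bounded_near_0 as [d [C0 [Hd HC0]]].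
  set (C := Rmax 1 C0).
  assert (HC1 : 1 <= C) by apply Rmax_l.
  assert (HC : forall t x, 0 <= t <= d -> norm (S t x) <= C * norm x).
  { intros t x Ht. apply Rle_trans with (1 := HC0 t x Ht).
    apply Rmult_le_compat_r; [apply norm_ge_0|apply Rmax_r]. }
  assert (Hpow : forall n t x, 0 <= t <= INR n * d -> norm (S t x) <= C ^ n * norm x).
  { induction n as [|n IH]; intros t x Ht.
    - simpl in Ht. replace t with 0 by lra. rewrite (semigroup_0 S HS). simpl. lra.
    - rewrite S_INR in Ht. simpl.
      assert (Hn : 0 <= C ^ n) by (apply pow_le; lra).
      destruct (Rle_lt_dec t d) as [Htd|Htd].
      + apply Rle_trans with (1 := HC t x ltac:(lra)).
        apply Rmult_le_compat_r; [apply norm_ge_0|].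
        pose proof (pow_R1_Rle C n HC1). nra.
      + replace t with ((t - d) + d) by ring.
        rewrite (semigroup_plus S HS) by lra.
        apply Rle_trans with (1 := IH (t - d) (S d x) ltac:(lra)).
        specialize (HC d x ltac:(lra)).
        replace (C * C ^ n * norm x) with (C ^ n * (C * norm x)) by ring.
        now apply Rmult_le_compat_l. }
  destruct (INR_unbounded (tau / d)) as [n Hn].
  exists (C ^ n). split; [now apply pow_R1_Rle|].
  intros t x Ht. apply Hpow. split; [lra|].
  apply Rmult_lt_compat_r with (r := d) in Hn; auto.
  replace (tau / d * d) with tau in Hn by (field; lra). lra.
Qed.

Lemma semigroup_increment (a h : R) (x : E) :
  0 <= a -> 0 <= h -> minus (S (a + h) x) (S a x) = S a (minus (S h x) x).
Proof.
  intros Ha Hh. rewrite (semigroup_plus S HS) by auto.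
  rewrite linear_minus_eq; [reflexivity|now apply (semigroup_linear S HS)].
Qed.

(** On either side of [t0] the increment is [S a] applied to [S (b - a) x - x] with [a] the smaller
    time, and [S a] is bounded uniformly in [a]. *)
Lemma semigroup_strong_cont (x : E) (t0 eps : R) :
  0 <= t0 -> 0 < eps -> exists d, 0 < d /\
    forall t, 0 <= t -> Rabs (t - t0) < d -> norm (minus (S t x) (S t0 x)) < eps.
Proof.
  intros Ht0 He. destruct (semigroup_bounded (t0 + 1)) as [C [HC1 HC]].
  destruct (semigroup_right_cont x (eps / C)) as [d [Hd K]];
    [apply Rdiv_lt_0_compat; lra|].
  assert (Hinc : forall a b, 0 <= a <= b -> b <= t0 + 1 -> b - a < d ->
            norm (minus (S b x) (S a x)) < eps).
  { intros a b Hab Hb Hd'. replace b with (a + (b - a)) by ring.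
    rewrite semigroup_increment by lra.
    apply Rle_lt_trans with (1 := HC a _ ltac:(lra)).
    specialize (K (b - a) ltac:(lra)).
    apply Rmult_lt_compat_l with (r := C) in K; [|lra].
    replace (C * (eps / C)) with eps in K by (field; lra). exact K. }
  exists (Rmin d 1). split; [apply Rmin_glb_lt; lra|].
  intros t Ht Htd. pose proof (Rmin_l d 1). pose proof (Rmin_r d 1).
  apply Rabs_lt_between in Htd.
  destruct (Rle_lt_dec t t0).
  - rewrite norm_minus_sym. apply Hinc; lra.
  - apply Hinc; lra.
Qed.

(* [Rmax 0] makes the semigroup total on [R], so that two-sided continuity makes sense. *)
Lemma semigroup_joint_cont (tau : R -> R) (y : R -> E) (s0 : R) :
  continuous tau s0 -> continuous y s0 ->
  continuous (fun s => S (Rmax 0 (tau s)) (y s)) s0.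
Proof.
  intros Htau Hy. apply continuous_norm_iff. intros eps He.
  set (t0 := Rmax 0 (tau s0)).
  destruct (semigroup_bounded (t0 + 1)) as [C [HC1 HC]].
  destruct (proj1 (continuous_norm_iff y s0) Hy (eps / 2 / C)) as [d1 [Hd1 K1]];
    [apply Rdiv_lt_0_compat; lra|].
  destruct (semigroup_strong_cont (y s0) t0 (eps / 2)) as [d2 [Hd2 K2]];
    [apply Rmax_l|lra|].
  destruct (proj1 (continuous_norm_iff (E := R_CompleteNormedModule) tau s0) Htau
              (Rmin d2 1)) as [d3 [Hd3 K3]]; [apply Rmin_glb_lt; lra|].
  exists (Rmin d1 d3). split; [now apply Rmin_glb_lt|].
  intros s Hs. pose proof (Rmin_l d1 d3). pose proof (Rmin_r d1 d3).
  pose proof (Rmin_l d2 1). pose proof (Rmin_r d2 1).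
  specialize (K1 s ltac:(lra)). specialize (K3 s ltac:(lra)).
  change (Rabs (tau s - tau s0) < Rmin d2 1) in K3.
  set (t := Rmax 0 (tau s)).
  (* Clipping by [Rmax 0] does not increase distances. *)
  assert (Ht : Rabs (t - t0) < Rmin d2 1).
  { apply Rle_lt_trans with (2 := K3). unfold t, t0, Rmax.
    destruct (Rle_dec 0 (tau s)), (Rle_dec 0 (tau s0)); unfold Rabs;
      repeat destruct Rcase_abs; lra. }
  assert (Ht0 : 0 <= t) by apply Rmax_l.
  apply Rle_lt_trans with (1 := norm_minus_le_trans _ (S t (y s0)) _).
  specialize (K2 t Ht0 ltac:(lra)). fold t0.
  rewrite <- linear_minus_eq by now apply (semigroup_linear S HS).
  assert (HC' := HC t (minus (y s) (y s0))).
  assert (Htle : t <= t0 + 1) by (apply Rabs_lt_between in Ht; lra).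
  specialize (HC' ltac:(lra)).
  apply Rmult_lt_compat_l with (r := C) in K1; [|lra].
  replace (C * (eps / 2 / C)) with (eps / 2) in K1 by (field; lra). lra.
Qed.

End Semigroup.

(** * Integrals over short, shifted and identical intervals *)

Section Integrals.

Context {E : CompleteNormedModule R_AbsRing}.

(** The integrand may depend on [h], as the Duhamel integrand [S (t + h - s) (F (z s))] does. *)
Lemma integral_little_o (f : R -> R -> E) (I : R -> E) (y : E) (t : R) :
  (forall h, 0 < h -> is_RInt (f h) t (t + h) (I h)) ->
  (forall eps, 0 < eps -> exists d, 0 < d /\
     forall h s, 0 < h < d -> t <= s <= t + h -> norm (minus (f h s) y) <= eps) ->
  little_o (fun h => minus (I h) (scal h y)).
Proof.
  intros HI Hf eps He. destruct (Hf eps He) as [d [Hd K]].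
  exists d. split; auto. intros h Hh.
  apply (norm_RInt_le (fun s => minus (f h s) y) (fun _ => eps) t (t + h)).
  - lra.
  - intros s Hs. now apply K.
  - replace (scal h y) with (scal (t + h - t) y) by module_eq.
    apply (is_RInt_minus (V := E)); [apply HI; lra|apply (is_RInt_const (V := E))].
  - replace (eps * h) with ((t + h - t) * eps) by ring.
    apply (is_RInt_const (V := R_NormedModule)).
Qed.

Lemma is_RInt_shift (f : R -> E) (a b v : R) (I : E) :
  is_RInt f (a + v) (b + v) I -> is_RInt (fun s => f (s + v)) a b I.
Proof.
  intros H. apply (is_RInt_ext (V := E) (fun s => scal 1 (f (1 * s + v)))).
  - intros s _. rewrite Rmult_1_l. module_eq.
  - apply (is_RInt_comp_lin (V := E)). now rewrite !Rmult_1_l.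
Qed.

Lemma is_RInt_uniq (f : R -> E) (a b : R) (I J : E) :
  is_RInt f a b I -> is_RInt f a b J -> I = J.
Proof.
  intros HI HJ. rewrite <- (is_RInt_unique (V := E) f a b I HI).
  exact (is_RInt_unique (V := E) f a b J HJ).
Qed.

End Integrals.

(** * The generator: stability, density of the domain, commutation *)

Section Generator.

Context {E : CompleteNormedModule R_AbsRing}.
Context (S : R -> E -> E) (D : E -> Prop) (A : E -> E).
Context (HS : C0_semigroup S) (HA : is_generator S D A).

Lemma generator_little_o (x : E) :
  D x -> little_o (fun h => minus (minus (S h x) x) (scal h (A x))).
Proof.
  intros Hx. apply at_right_little_o. exact (generator_val S D A HA x Hx).
Qed.

(** One expansion yields both membership in the domain and, by uniqueness of right derivatives, the
    value of [A]. *)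
Lemma generator_intro (x y : E) :
  little_o (fun h => minus (minus (S h x) x) (scal h y)) -> D x /\ A x = y.
Proof.
  intros H. assert (Hx : D x).
  { apply (generator_dom S D A HA). exists y.
    apply (at_right_little_o (fun h => minus (S h x) x)). exact H. }
  split; auto. apply minus_eq_zero_norm.
  replace (minus (A x) y) with (zero : E); [right; apply (norm_zero (V := E))|].
  symmetry. apply little_o_unique.
  apply little_o_ext with (fun h =>
    minus (minus (minus (S h x) x) (scal h y))
          (minus (minus (S h x) x) (scal h (A x)))).
  - intros h _. module_eq.
  - apply little_o_minus; auto.
    now apply generator_little_o.
Qed.

Lemma generator_scal (k : R) (x : E) : D x -> D (scal k x).
Proof.
  intros Hx. apply (generator_intro (scal k x) (scal k (A x))).
  apply little_o_ext with
    (fun h => scal k (minus (minus (S h x) x) (scal h (A x)))).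
  - intros h Hh. rewrite (linear_scal_eq (S h)) by (apply (semigroup_linear S HS); lra).
    module_eq.
  - apply (little_o_bounded_family (fun _ v => scal k v) (Rabs k) 1); [lra| |].
    + intros h v _. rewrite norm_scal_eq. lra.
    + now apply generator_little_o.
Qed.

Lemma generator_minus (x y : E) :
  D x -> D y -> D (minus x y) /\ A (minus x y) = minus (A x) (A y).
Proof.
  intros Hx Hy. apply generator_intro.
  apply little_o_ext with (fun h =>
    minus (minus (minus (S h x) x) (scal h (A x)))
          (minus (minus (S h y) y) (scal h (A y)))).
  - intros h Hh. rewrite (linear_minus_eq (S h)) by (apply (semigroup_linear S HS); lra).
    module_eq.
  - apply little_o_minus; [now apply generator_little_o|].
    now apply generator_little_o.
Qed.

Lemma generator_semigroup (t : R) (x : E) :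
  0 <= t -> D x -> D (S t x) /\ A (S t x) = S t (A x).
Proof.
  intros Ht Hx. assert (Hl := semigroup_linear S HS t Ht). apply generator_intro.
  apply little_o_ext with
    (fun h => S t (minus (minus (S h x) x) (scal h (A x)))).
  - intros h Hh. rewrite !(linear_minus_eq (S t)), (linear_scal_eq (S t)) by auto.
    rewrite <- !(semigroup_plus S HS) by lra. now rewrite (Rplus_comm t h).
  - apply little_o_linear; auto. now apply generator_little_o.
Qed.

(** The averages of [S s x] over [[0, a]] tend to [x]. They lie in the domain because applying [S h]
    shifts the interval, so the increment is the integral over [[a, a + h]] minus that over
    [[0, h]], with right derivative [S a x - x]. *)
Lemma generator_dense (x : E) (eps : R) :
  0 < eps -> exists y, D y /\ norm (minus y x) < eps.
Proof.
  intros He. set (f := fun s => S (Rmax 0 s) x).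
  assert (Hf : forall s, continuous f s).
  { intros s. apply (semigroup_joint_cont S HS (fun s => s) (fun _ => x)).
    - apply continuous_id.
    - apply continuous_const. }
  assert (Hex : forall a b, ex_RInt f a b).
  { intros a b. apply (ex_RInt_continuous (V := E)). auto. }
  assert (Hint : forall a, little_o (fun h => minus (RInt f a (a + h)) (scal h (f a)))).
  { intros a. apply (integral_little_o (fun _ => f) (fun h => RInt f a (a + h)) (f a) a).
    - intros h _. apply (RInt_correct (V := E)). apply Hex.
    - intros e He'. destruct (proj1 (continuous_norm_iff f a) (Hf a) e He') as [d [Hd K]].
      exists d. split; auto. intros h s Hh Hs. apply Rlt_le, K.
      apply Rabs_lt_between. lra. }
  assert (HD : forall a, 0 < a -> D (RInt f 0 a)).
  { intros a Ha. apply (generator_intro _ (minus (f a) (f 0))).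
    apply little_o_ext with (fun h =>
      minus (minus (RInt f a (a + h)) (scal h (f a)))
            (minus (RInt f 0 (0 + h)) (scal h (f 0)))).
    - intros h Hh.
      assert (HSh : S h (RInt f 0 a) = RInt f h (a + h)).
      { apply (is_RInt_uniq (fun s => f (s + h)) 0 a).
        - apply (is_RInt_ext (V := E) (fun s => S h (f s))).
          + intros s Hs. rewrite Rmin_left, Rmax_right in Hs by lra.
            unfold f. rewrite !Rmax_right by lra.
            rewrite <- (semigroup_plus S HS) by lra. now rewrite Rplus_comm.
          + apply is_RInt_linear; [apply (semigroup_linear S HS); lra|].
            apply (RInt_correct (V := E)). apply Hex.
        - apply is_RInt_shift. rewrite Rplus_0_l.
          apply (RInt_correct (V := E)). apply Hex. }
      rewrite HSh, Rplus_0_l.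
      pose proof (RInt_Chasles (V := E) f 0 h (a + h) (Hex _ _) (Hex _ _)) as H1.
      pose proof (RInt_Chasles (V := E) f 0 a (a + h) (Hex _ _) (Hex _ _)) as H2.
      rewrite <- H2 in H1. clear H2.
      replace (RInt f h (a + h)) with
        (minus (plus (RInt f 0 h) (RInt f h (a + h))) (RInt f 0 h)) by module_eq.
      rewrite H1. module_eq.
    - apply little_o_minus; apply Hint. }
  destruct (Hint 0 (eps / 2)) as [d [Hd K]]; [lra|].
  specialize (K (d / 2) ltac:(lra)). rewrite Rplus_0_l in K.
  set (a := d / 2) in *.
  exists (scal (/ a) (RInt f 0 a)). split.
  - apply generator_scal, HD. unfold a. lra.
  - assert (Hf0 : f 0 = x).
    { unfold f. rewrite Rmax_left by lra. apply (semigroup_0 S HS). }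
    rewrite Hf0 in K.
    assert (Ha : 0 < a) by (unfold a; lra).
    assert (Heq : minus (scal (/ a) (RInt f 0 a)) x =
                  scal (/ a) (minus (RInt f 0 a) (scal a x))).
    { module_eq_with ltac:(try field; lra). }
    apply Rle_lt_trans with (1 := Req_le _ _ (f_equal norm Heq)).
    apply Rle_lt_trans with (1 := Req_le _ _ (norm_scal_eq _ _)).
    rewrite Rabs_pos_eq by (apply Rlt_le, Rinv_0_lt_compat; auto).
    apply Rle_lt_trans with (/ a * (eps / 2 * a)).
    + apply Rmult_le_compat_l; auto. apply Rlt_le, Rinv_0_lt_compat; auto.
    + replace (/ a * (eps / 2 * a)) with (eps / 2) by (field; lra). lra.
Qed.

(* For [x] in the domain, [s |-> S (t - s) (P (S s x))] has right derivative
   [S (t - s) (P A - A P) (S s x) = 0], hence equal values at [0] and [t]. *)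
Lemma semigroup_commute (P : E -> E) :
  is_linear P -> (forall x, D x -> D (P x) /\ A (P x) = P (A x)) ->
  forall t x, 0 <= t -> P (S t x) = S t (P x).
Proof.
  intros HP HPA t x Ht.
  assert (HStl := semigroup_linear S HS t Ht).
  assert (HD : forall y, D y -> P (S t y) = S t (P y)).
  { intros y Hy.
    set (eta := fun s => S (Rmax 0 (t - s)) (P (S (Rmax 0 s) y))).
    assert (Heta : norm (minus (eta t) (eta 0)) <= 0 * (t - 0)).
    { apply right_mean_value; auto.
      - intros s _. apply (semigroup_joint_cont S HS (fun s => t - s)).
        + apply (continuous_minus (V := R_NormedModule));
            [apply continuous_const|apply continuous_id].
        + apply (continuous_comp (fun s => S (Rmax 0 s) y) P).
          * apply (semigroup_joint_cont S HS (fun s => s) (fun _ => y)).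
            -- apply continuous_id.
            -- apply continuous_const.
          * now apply linear_continuous.
      - intros s Hs eps He.
        set (w := S s y).
        destruct (generator_semigroup s y ltac:(lra) Hy) as [Hw _]. fold w in Hw.
        destruct (HPA w Hw) as [HPw HAPw].
        (* Both terms are expanded at [w]; the first-order parts cancel because
           [A (P w) = P (A w)]. *)
        assert (Hlo : little_o (fun h => minus (P (S h w)) (S h (P w)))).
        { apply little_o_ext with (fun h =>
            minus (P (minus (minus (S h w) w) (scal h (A w))))
                  (minus (minus (S h (P w)) (P w)) (scal h (A (P w))))).
          - intros h _. rewrite !(linear_minus_eq P), (linear_scal_eq P), HAPw by auto.
            module_eq.
          - apply little_o_minus.
            + apply little_o_linear; auto. now apply generator_little_o.
            + now apply generator_little_o. }
        destruct (semigroup_bounded S HS t) as [C [_ HC]].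
        assert (Hlo' : little_o (fun h =>
                  S (t - s - h) (minus (P (S h w)) (S h (P w))))).
        { apply (little_o_bounded_family (fun h => S (t - s - h)) C (t - s)); auto; [lra|].
          intros h v Hh. apply HC. lra. }
        destruct (Hlo' eps He) as [d [Hd K]].
        exists (Rmin d (t - s)). split; [apply Rmin_glb_lt; lra|].
        intros h Hh. pose proof (Rmin_l d (t - s)). pose proof (Rmin_r d (t - s)).
        specialize (K h ltac:(lra)).
        replace (minus (eta (s + h)) (eta s))
          with (S (t - s - h) (minus (P (S h w)) (S h (P w)))); [lra|].
        assert (Hl : is_linear (S (t - s - h))) by (apply (semigroup_linear S HS); lra).
        rewrite (linear_minus_eq _ _ _ Hl). unfold eta, w.
        rewrite !(Rmax_right 0) by lra. f_equal.
        + rewrite <- (semigroup_plus S HS) by lra.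
          replace (t - (s + h)) with (t - s - h) by ring.
          now rewrite (Rplus_comm s h).
        + rewrite <- (semigroup_plus S HS (t - s - h)) by lra. f_equal. ring. }
    rewrite Rmult_0_l in Heta. apply minus_eq_zero_norm in Heta. unfold eta in Heta.
    rewrite Rminus_0_r, Rminus_diag, (Rmax_left 0 0), (Rmax_right 0 t) in Heta by lra.
    now rewrite !(semigroup_0 S HS) in Heta. }
  destruct (linear_bound _ HP) as [C1 [HC1 K1]].
  destruct (linear_bound _ HStl) as [C2 [HC2 K2]].
  apply minus_eq_zero_norm. apply le_epsilon. intros eps He. rewrite Rplus_0_l.
  assert (HCpos : 0 < 2 * C1 * C2) by (apply Rmult_lt_0_compat; lra).
  destruct (generator_dense x (eps / (2 * C1 * C2))) as [y [Hy Hyx]];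
    [now apply Rdiv_lt_0_compat|].
  (* For [y] in the domain the commutator vanishes, so only [y - x] contributes, and it is small by
     density. *)
  replace (minus (P (S t x)) (S t (P x)))
    with (minus (S t (P (minus y x))) (P (S t (minus y x)))).
  2:{ rewrite (linear_minus_eq P y x), !(linear_minus_eq (S t)), (linear_minus_eq P) by auto.
      rewrite (HD y Hy). module_eq. }
  pose proof (norm_minus_le (S t (P (minus y x))) (P (S t (minus y x)))) as H0.
  pose proof (K2 (P (minus y x))) as H1. pose proof (K1 (S t (minus y x))) as H2.
  pose proof (K1 (minus y x)) as H3. pose proof (K2 (minus y x)) as H4.
  apply Rmult_le_compat_l with (r := C2) in H3; [|lra].
  apply Rmult_le_compat_l with (r := C1) in H4; [|lra].
  apply Rmult_lt_compat_l with (r := 2 * C1 * C2) in Hyx; auto.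
  replace (2 * C1 * C2 * (eps / (2 * C1 * C2))) with eps in Hyx by (field; lra).
  lra.
Qed.

End Generator.

(** * Periodic functions *)

Section Periodic.

Context {E : CompleteNormedModule R_AbsRing}.
Context (z : R -> E) (T : R) (HT : 0 < T) (Hper : forall t, z (t + T) = z t).

Lemma periodic_nat (n : nat) (t : R) : z (t + INR n * T) = z t.
Proof.
  induction n as [|n IH].
  - simpl. f_equal. ring.
  - rewrite S_INR. replace (t + (INR n + 1) * T) with (t + INR n * T + T) by ring.
    now rewrite Hper.
Qed.

(** Base point 0 serves the compactness argument; a general [a] places one time within a period
    after another in [plus_estimate]. *)
Lemma periodic_representative (a t : R) : exists s, a <= s <= a + T /\ z s = z t.
Proof.
  set (r := (t - a) / T).
  assert (Hr : r * T = t - a) by (unfold r; field; lra).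
  set (n := Int_part r).
  destruct (base_Int_part r) as [H1 H2]. fold n in H1, H2.
  apply Rmult_le_compat_r with (r := T) in H1; [|lra].
  apply Rgt_lt, Rmult_lt_compat_r with (r := T) in H2; auto.
  exists (t - IZR n * T). split; [lra|].
  (* [periodic_nat] only adds periods, so the sign of [n] decides which of the two times is
     moved. *)
  destruct (Z.le_gt_cases 0 n) as [Hn|Hn].
  - rewrite <- (periodic_nat (Z.to_nat n)), INR_IZR_INZ, Z2Nat.id by auto.
    f_equal. ring.
  - replace (t - IZR n * T) with (t + INR (Z.to_nat (- n)) * T).
    + apply periodic_nat.
    + rewrite INR_IZR_INZ, Z2Nat.id, opp_IZR by lia. ring.
Qed.

Lemma periodic_oscillation (Hz : forall t, continuous z t) :
  exists B, forall t s, norm (minus (z t) (z s)) <= B.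
Proof.
  destruct (continuity_ab_maj (fun t => norm (z t)) 0 T) as [t0 [Ht0 _]]; [lra| |].
  - intros c _. apply continuity_pt_filterlim.
    apply (continuous_comp z norm); [apply Hz|exact (filterlim_norm (z c))].
  - exists (2 * norm (z t0)). intros t s.
    destruct (periodic_representative 0 t) as [t' [Ht' <-]].
    destruct (periodic_representative 0 s) as [s' [Hs' <-]].
    pose proof (Ht0 t' ltac:(lra)). pose proof (Ht0 s' ltac:(lra)).
    pose proof (norm_minus_le (z t') (z s')). lra.
Qed.

(** The least bound is needed because the estimates bound each oscillation partly by itself, and
    such terms are absorbed. *)
Lemma oscillation_sup (y : R -> E) (B : R) :
  (forall t s, norm (minus (y t) (y s)) <= B) ->
  exists sigma, (forall t s, norm (minus (y t) (y s)) <= sigma) /\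
    forall b, (forall t s, norm (minus (y t) (y s)) <= b) -> sigma <= b.
Proof.
  intros HB.
  destruct (completeness (fun r => exists t s, r = norm (minus (y t) (y s))))
    as [sigma [Hub Hlub]].
  - exists B. intros r [t [s ->]]. auto.
  - exists (norm (minus (y 0) (y 0))), 0, 0. reflexivity.
  - exists sigma. split.
    + intros t s. apply Hub. now exists t, s.
    + intros b Hb. apply Hlub. intros r [t [s ->]]. auto.
Qed.

End Periodic.

(** * Bounds from the operator norm *)

Section OperatorNorm.

Context {E G : CompleteNormedModule R_AbsRing}.

(** The only algebraic input is homogeneity, so the bound is available before [is_linear], which
    itself contains boundedness. *)
Lemma op_norm_bound (f : E -> G) (K : R) :
  (forall k x, f (scal k x) = scal k (f x)) -> Rbar_le (op_norm f) K ->
  forall x, norm (f x) <= K * norm x.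
Proof.
  intros Hf HK x.
  assert (Hunit : forall y, norm y <= 1 -> norm (f y) <= K).
  { intros y Hy. change (Rbar_le (norm (f y)) K). apply Rbar_le_trans with (2 := HK).
    apply (proj1 (Lub_Rbar_correct _)). now exists y. }
  destruct (Rle_lt_or_eq_dec 0 (norm x) (norm_ge_0 x)) as [Hx|Hx].
  - assert (Hi : 0 < / norm x) by now apply Rinv_0_lt_compat.
    assert (H : norm (f (scal (/ norm x) x)) <= K).
    { apply Hunit. rewrite norm_scal_eq, Rabs_pos_eq, Rinv_l; lra. }
    rewrite Hf, norm_scal_eq, Rabs_pos_eq in H by lra.
    apply Rmult_le_compat_r with (r := norm x) in H; [|lra].
    replace (/ norm x * norm (f x) * norm x) with (norm (f x)) in H by (field; lra).
    exact H.
  - assert (Hx0 : scal 0 x = x).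
    { transitivity (zero : E); [module_eq|].
      symmetry. apply (norm_eq_zero x). auto. }
    rewrite <- Hx0, Hf, !norm_scal_eq, Rabs_R0. lra.
Qed.

End OperatorNorm.

(** * Projections of a closed direct sum *)

Section Projections.

Context {E G : CompleteNormedModule R_AbsRing}.

Lemma subspace_minus (P : E -> Prop) (x y : E) :
  closed_subspace P -> P x -> P y -> P (minus x y).
Proof.
  intros HP Hx Hy. replace (minus x y) with (plus x (scal (-1) y)) by module_eq.
  apply (subspace_plus P HP); auto. now apply (subspace_scal P HP).
Qed.

Context (iota : G -> E) (Em Ep : E -> Prop) (Pm : E -> E) (Pp : E -> G).
Context (Hinj : forall v w, iota v = iota w -> v = w) (Hiota : is_linear iota).
Context (Hsum : closed_direct_sum Em Ep) (HP : are_projections iota Em Ep Pm Pp).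

(** The difference of two decompositions lies in both subspaces. The algebraic properties of the
    projections follow by exhibiting a decomposition. *)
Lemma direct_sum_unique (x a : E) (b : G) :
  Em a -> Ep (iota b) -> x = plus a (iota b) -> Pm x = a /\ Pp x = b.
Proof.
  intros Ha Hb Hx. destruct (HP x) as [Hma [Hpb Hx']].
  assert (Hd : minus (Pm x) a = minus (iota b) (iota (Pp x))).
  { replace (Pm x) with (minus (plus (Pm x) (iota (Pp x))) (iota (Pp x))) by module_eq.
    rewrite <- Hx', Hx. module_eq. }
  assert (H0 : minus (Pm x) a = zero).
  { apply (direct_sum_disjoint Em Ep Hsum).
    - apply subspace_minus; auto. apply (direct_sum_m Em Ep Hsum).
    - rewrite Hd. apply subspace_minus; auto. apply (direct_sum_p Em Ep Hsum). }
  split.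
  - apply minus_eq_zero_norm. rewrite H0. right. apply (norm_zero (V := E)).
  - symmetry. apply Hinj, minus_eq_zero_norm. rewrite <- Hd, H0.
    right. apply (norm_zero (V := E)).
Qed.

Lemma projections_plus (x y : E) :
  Pm (plus x y) = plus (Pm x) (Pm y) /\ Pp (plus x y) = plus (Pp x) (Pp y).
Proof.
  destruct (HP x) as [Hxm [Hxp Hx]]. destruct (HP y) as [Hym [Hyp Hy]].
  apply direct_sum_unique.
  - apply (subspace_plus _ (direct_sum_m Em Ep Hsum)); auto.
  - rewrite (linear_plus_eq iota) by auto.
    apply (subspace_plus _ (direct_sum_p Em Ep Hsum)); auto.
  - rewrite Hx at 1. rewrite Hy at 1. rewrite (linear_plus_eq iota) by auto. module_eq.
Qed.

Lemma projections_scal (k : R) (x : E) :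
  Pm (scal k x) = scal k (Pm x) /\ Pp (scal k x) = scal k (Pp x).
Proof.
  destruct (HP x) as [Hxm [Hxp Hx]].
  apply direct_sum_unique.
  - apply (subspace_scal _ (direct_sum_m Em Ep Hsum)); auto.
  - rewrite (linear_scal_eq iota) by auto.
    apply (subspace_scal _ (direct_sum_p Em Ep Hsum)); auto.
  - rewrite Hx at 1. rewrite (linear_scal_eq iota) by auto. module_eq.
Qed.

Lemma projections_linear (K : R) :
  Rbar_le (op_norm Pm) K -> Rbar_le (op_norm Pp) K ->
  (forall x, norm (Pm x) <= K * norm x) /\ (forall x, norm (Pp x) <= K * norm x) /\
  is_linear Pm /\ is_linear Pp.
Proof.
  intros HKm HKp.
  assert (Hm : forall x, norm (Pm x) <= K * norm x).
  { apply op_norm_bound; auto. intros k x. apply projections_scal. }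
  assert (Hp : forall x, norm (Pp x) <= K * norm x).
  { apply op_norm_bound; auto. intros k x. apply projections_scal. }
  (* [is_linear] asks for a strictly positive bounding constant. *)
  assert (HK : 0 < Rabs K + 1) by (pose proof (Rabs_pos K); lra).
  split; [exact Hm|]. split; [exact Hp|]. split; split.
  - intros x y. apply projections_plus.
  - intros k x. apply projections_scal.
  - exists (Rabs K + 1). split; auto. intros x. apply Rle_trans with (1 := Hm x).
    apply Rmult_le_compat_r; [apply norm_ge_0|]. pose proof (Rle_abs K). lra.
  - intros x y. apply projections_plus.
  - intros k x. apply projections_scal.
  - exists (Rabs K + 1). split; auto. intros x. apply Rle_trans with (1 := Hp x).
    apply Rmult_le_compat_r; [apply norm_ge_0|]. pose proof (Rle_abs K). lra.
Qed.

Lemma projections_plus_space (v : G) : Ep (iota v) -> Pp (iota v) = v.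
Proof.
  intros Hv. apply (direct_sum_unique (iota v) zero v); auto.
  - apply (subspace_zero _ (direct_sum_m Em Ep Hsum)).
  - module_eq.
Qed.

Lemma projections_minus_space (x : E) : Em x -> Pm x = x /\ Pp x = zero.
Proof.
  intros Hx. apply direct_sum_unique; auto.
  - rewrite (linear_zero_eq iota) by auto. apply (subspace_zero _ (direct_sum_p Em Ep Hsum)).
  - rewrite (linear_zero_eq iota) by auto. module_eq.
Qed.

End Projections.

(** * Estimates for a fixed spectral parameter *)

Section FixedDecomposition.

Context {X V : CompleteNormedModule R_AbsRing}.
Context (S : R -> X -> X) (D : X -> Prop) (A : X -> X) (iota : V -> X)
  (SV : R -> V -> V) (Xm Xp : X -> Prop) (Pm : X -> X) (Pp : X -> V)
  (M L K mu T : R) (F : V -> X) (z : R -> V).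
Context (HS : C0_semigroup S) (HA : is_generator S D A)
  (Hinj : forall v w, iota v = iota w -> v = w) (Hiota : is_linear iota)
  (Hsmooth : forall t x, 0 < t -> exists v, iota v = S t x)
  (HSViota : forall t v, 0 <= t -> iota (SV t v) = S t (iota v))
  (HSV : C0_semigroup SV)
  (Hmu : 0 < mu) (HM : 0 < M) (Hsum : closed_direct_sum Xm Xp)
  (Hplus : D_plus D A iota M mu Xp) (Hminus : D_minus S D A iota (fun _ => 1) mu Xm)
  (HP : are_projections iota Xm Xp Pm Pp)
  (HPm : is_linear Pm) (HPp : is_linear Pp)
  (HKm : forall x, norm (Pm x) <= K * norm x)
  (HKp : forall x, norm (Pp x) <= K * norm x)
  (HK : 0 <= K) (HL : 0 < L) (HF : lipschitz F L)
  (Hz : mild_solution S iota F m_infty p_infty z)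
  (HT : 0 < T) (Hper : forall t, z (t + T) = z t).

(** The projection onto the plus space read inside [X], where it can be composed with [S] and
    [A]. *)
Let P (x : X) : X := iota (Pp x).
Let v (t : R) : V := Pp (iota (z t)).
(** [Pm] has values in [X] only; the difference gives an element of [V] whose image is
    [Pm (iota (z t))]. *)
Let w (t : R) : V := minus (z t) (v t).

Lemma P_linear : is_linear P.
Proof.
  exact (is_linear_comp Pp iota HPp Hiota).
Qed.

Lemma Pm_minus_P (x : X) : Pm x = minus x (P x).
Proof.
  destruct (HP x) as [_ [_ Hx]]. rewrite Hx at 2. unfold P. module_eq.
Qed.

Lemma P_id (y : X) : Xp y -> P y = y.
Proof.
  intros Hy. destruct (HP y) as [Hm [Hp Hy']].
  assert (H0 : Pm y = zero).
  { apply (direct_sum_disjoint Xm Xp Hsum); auto.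
    rewrite Pm_minus_P. apply subspace_minus; auto. apply (direct_sum_p Xm Xp Hsum). }
  rewrite Hy' at 2. rewrite H0. unfold P. module_eq.
Qed.

(** In [A x = A (Pm x) + A (P x)] the invariance of the two spaces puts the summands in [Xm] and
    [Xp], so the second one is [P (A x)]. *)
Lemma P_generator (x : X) : D x -> D (P x) /\ A (P x) = P (A x).
Proof.
  intros Hx. destruct (HP x) as [Hm [Hp Hx']].
  assert (HDp : D (P x)) by exact (D_plus_dom D A iota M mu Xp Hplus _ Hp).
  split; auto.
  destruct (generator_minus S D A HS HA x (P x) Hx HDp) as [HDm HAm].
  rewrite <- Pm_minus_P in HDm, HAm.
  assert (HXm := D_minus_inv S D A iota _ mu Xm Hminus _ Hm HDm).
  assert (HXp := D_plus_inv D A iota M mu Xp Hplus _ Hp).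
  destruct (HP (A (P x))) as [HQm [HQp HQ]].
  assert (HPA : Pp (A x) = Pp (A (P x))).
  { replace (A x) with (plus (A (Pm x)) (A (P x))) by (rewrite HAm; module_eq).
    rewrite (linear_plus_eq Pp) by auto.
    destruct (projections_minus_space iota Xm Xp Pm Pp Hinj Hiota Hsum HP _ HXm)
      as [_ ->]. module_eq. }
  unfold P at 2. rewrite HPA. symmetry. now apply P_id.
Qed.

Lemma P_commute (t : R) (x : X) : 0 <= t -> P (S t x) = S t (P x).
Proof.
  apply (semigroup_commute S D A HS HA); [exact P_linear|exact P_generator].
Qed.

Lemma Pm_commute (t : R) (x : X) : 0 <= t -> Pm (S t x) = S t (Pm x).
Proof.
  intros Ht. rewrite !Pm_minus_P, P_commute by auto.
  now rewrite (linear_minus_eq (S t)) by now apply (semigroup_linear S HS).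
Qed.

Lemma minus_space_invariant (t : R) (x : X) : 0 <= t -> Xm x -> Xm (S t x).
Proof.
  intros Ht Hx.
  destruct (projections_minus_space iota Xm Xp Pm Pp Hinj Hiota Hsum HP x Hx) as [<- _].
  rewrite <- Pm_commute by auto. apply HP.
Qed.

Lemma SV_decay (t : R) (u : V) :
  0 <= t -> Xm (iota u) -> norm (SV t u) <= exp (- mu * t) * norm u.
Proof.
  intros Ht Hu. destruct (Rle_lt_or_eq_dec 0 t Ht) as [H0|<-].
  - destruct (D_minus_VV S D A iota _ mu Xm Hminus t u H0 Hu) as [u' [Hu' Hn]].
    replace (SV t u) with u'; auto. apply Hinj. rewrite HSViota; auto.
  - rewrite (semigroup_0 SV HSV), Rmult_0_r, exp_0. lra.
Qed.

Lemma F_difference (a b Delta : R) :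
  norm (minus (z a) (z b)) <= Delta -> norm (minus (F (z a)) (F (z b))) <= L * Delta.
Proof.
  intros H. apply Rle_trans with (1 := HF _ _). apply Rmult_le_compat_l; [lra|exact H].
Qed.

Lemma z_continuous (t : R) : continuous z t.
Proof. now apply (mild_cont S iota F m_infty p_infty z Hz). Qed.

Lemma Fz_continuous (t : R) : continuous (fun s => F (z s)) t.
Proof.
  apply continuous_norm_iff. intros eps He.
  destruct (proj1 (continuous_norm_iff z t) (z_continuous t) (eps / L))
    as [d [Hd Kd]]; [now apply Rdiv_lt_0_compat|].
  exists d. split; auto. intros s Hs. specialize (Kd s Hs).
  apply Rle_lt_trans with (1 := HF _ _).
  apply Rmult_lt_compat_l with (r := L) in Kd; auto.
  replace (L * (eps / L)) with eps in Kd by (field; lra). exact Kd.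
Qed.

(** The factor [1 - exp (- mu * T)] cancels in [minus_estimate], leaving a bound independent of
    [T]. *)
Lemma minus_integral_bound (c t : R) :
  is_RInt (fun s => exp (- mu * (t - s)) * c) (t - T) t (c * (1 - exp (- mu * T)) / mu).
Proof.
  replace (c * (1 - exp (- mu * T)) / mu) with
    (minus (c / mu * exp (- mu * (t - t))) (c / mu * exp (- mu * (t - (t - T))))).
  - apply (is_RInt_derive (V := R_CompleteNormedModule) (fun s => c / mu * exp (- mu * (t - s)))).
    + intros s _. auto_derive; auto. change (t + - s) with (t - s). field. lra.
    + intros s _. apply (ex_derive_continuous (V := R_NormedModule)). auto_derive; auto.
  - unfold minus, plus, opp; simpl. rewrite Rminus_diag, Rmult_0_r, exp_0.
    replace (t - (t - T)) with T by ring. field. lra.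
Qed.

(* The integrand [S (t - s) g] is bounded but not known to be continuous in [V] at
   [s = t].  Applying [S delta] first makes it continuous in [V] up to the endpoint;
   then [delta] tends to [0]. *)
Lemma minus_estimate (Delta : R) :
  (forall t s, norm (minus (z t) (z s)) <= Delta) ->
  forall t s, norm (minus (w t) (w s)) <= K * L * Delta / mu.
Proof.
  intros HDelta t' t. set (h := t' - t).
  replace t' with (t + h) by (unfold h; ring). clearbody h. clear t'.
  set (dw := minus (w (t + h)) (w t)).
  set (g := fun s => Pm (minus (F (z (s + h))) (F (z s)))).
  assert (Hgm : forall s, Xm (g s)) by (intros s; apply HP).
  assert (Hgn : forall s, norm (g s) <= K * L * Delta).
  { intros s. apply Rle_trans with (1 := HKm _). rewrite Rmult_assoc.
    apply Rmult_le_compat_l; auto. now apply F_difference. }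
  assert (Hgc : forall s, continuous g s).
  { intros s. apply (continuous_comp (fun s => minus (F (z (s + h))) (F (z s))) Pm);
      [|now apply linear_continuous].
    apply (continuous_minus (V := X)); [|apply Fz_continuous].
    apply (continuous_comp (fun s => s + h) (fun s => F (z s))); [|apply Fz_continuous].
    apply (continuous_plus (V := R_NormedModule)); [apply continuous_id|apply continuous_const]. }
  assert (Hdw : iota dw = Pm (minus (iota (z (t + h))) (iota (z t)))).
  { unfold dw, w, v. rewrite (linear_minus_eq Pm), !Pm_minus_P by auto.
    rewrite !(linear_minus_eq iota) by auto. reflexivity. }
  assert (Hdwm : Xm (iota dw)) by (rewrite Hdw; apply HP).
  (* The mild equation over one period is written for [z] and for its translate by [h], on the same
     interval after a shift. By periodicity the initial difference is again the final one. *)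
  assert (Hint : exists I, is_RInt
              (fun s => S (t - s) (minus (F (z (s + h))) (F (z s)))) (t - T) t I /\
            iota dw = plus (S T (iota dw)) (Pm I)).
  { destruct (mild_eq S iota F m_infty p_infty z Hz (t - T + h) (t + h) Logic.I ltac:(lra) Logic.I)
      as [I1 [HI1 E1]].
    destruct (mild_eq S iota F m_infty p_infty z Hz (t - T) t Logic.I ltac:(lra) Logic.I)
      as [I2 [HI2 E2]].
    exists (minus I1 I2). split.
    - apply is_RInt_shift in HI1.
      apply (is_RInt_ext (V := X)
        (fun s => minus (S (t + h - (s + h)) (F (z (s + h)))) (S (t - s) (F (z s))))).
      + intros s Hs. rewrite Rmin_left, Rmax_right in Hs by lra.
        replace (t + h - (s + h)) with (t - s) by ring.
        rewrite (linear_minus_eq (S (t - s))); [reflexivity|apply (semigroup_linear S HS); lra].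
      + apply (is_RInt_minus (V := X)); auto.
    - assert (HST : is_linear (S T)) by (apply (semigroup_linear S HS); lra).
      replace (t + h - (t - T + h)) with T in E1 by ring.
      replace (t - (t - T)) with T in E2 by ring.
      rewrite <- (Hper (t - T + h)) in E1. rewrite <- (Hper (t - T)) in E2.
      replace (t - T + h + T) with (t + h) in E1 by ring.
      replace (t - T + T) with t in E2 by ring.
      rewrite Hdw, <- Pm_commute, <- (linear_plus_eq Pm) by (auto; lra). f_equal.
      rewrite E1 at 1. rewrite E2 at 1. rewrite (linear_minus_eq (S T)) by auto. module_eq. }
  destruct Hint as [I [HI HdwI]].
  assert (Hdelta : forall delta, 0 < delta -> norm (SV delta dw) <= K * L * Delta / mu).
  { intros delta Hd0.
    assert (HSd : is_linear (S delta)) by (apply (semigroup_linear S HS); lra).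
    (* [Q] is [S delta] with values in [V]; on the minus space it has norm at most 1 because [m] is
       1. *)
    destruct (functional_choice _ (fun x => Hsmooth delta x Hd0)) as [Q HQ].
    assert (HQn : forall x, Xm x -> norm (Q x) <= norm x).
    { intros x Hx.
      destruct (D_minus_XV S D A iota _ mu Xm Hminus delta x Hd0 Hx) as [u [Hu Hn]].
      replace (Q x) with u by (apply Hinj; rewrite HQ; auto).
      apply Rle_trans with (1 := Hn).
      assert (exp (- mu * delta) <= 1) by (rewrite <- exp_0; left; apply exp_increasing; nra).
      pose proof (norm_ge_0 x). nra. }
    assert (Hqc : forall s, continuous (fun s => Q (g s)) s).
    { intros s. apply continuous_norm_iff. intros eps He.
      destruct (proj1 (continuous_norm_iff g s) (Hgc s) eps He) as [d [Hd Kd]].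
      exists d. split; auto. intros s' Hs'.
      apply Rle_lt_trans with (2 := Kd s' Hs').
      replace (minus (Q (g s')) (Q (g s))) with (Q (minus (g s') (g s))).
      - apply HQn. apply subspace_minus; auto. apply (direct_sum_m Xm Xp Hsum).
      - apply Hinj. rewrite (linear_minus_eq iota), !HQ by auto.
        now apply (linear_minus_eq (S delta)). }
    (* A [V]-continuous integrand whose image in [X] is [S delta (S (t - s) (g s))] for [s <= t]. *)
    set (k := fun s => SV (Rmax 0 (t - s)) (Q (g s))).
    assert (Hk : is_RInt k (t - T) t (RInt k (t - T) t)).
    { apply (RInt_correct (V := V)). apply (ex_RInt_continuous (V := V)). intros s _.
      apply (semigroup_joint_cont SV HSV (fun s => t - s)); auto.
      apply (continuous_minus (V := R_NormedModule));
        [apply continuous_const|apply continuous_id]. }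
    set (J := RInt k (t - T) t) in *.
    assert (HJ : iota J = S delta (Pm I)).
    { apply (is_RInt_uniq (fun s => iota (k s)) (t - T) t); [now apply is_RInt_linear|].
      apply (is_RInt_ext (V := X)
        (fun s => S delta (Pm (S (t - s) (minus (F (z (s + h))) (F (z s))))))).
      - intros s Hs. rewrite Rmin_left, Rmax_right in Hs by lra.
        unfold k. rewrite Rmax_right, HSViota, HQ, Pm_commute by lra.
        rewrite <- !(semigroup_plus S HS) by lra. now rewrite Rplus_comm.
      - apply (is_RInt_linear (S delta)
          (fun s => Pm (S (t - s) (minus (F (z (s + h))) (F (z s)))))); auto.
        now apply is_RInt_linear. }
    assert (HJn : norm J <= K * L * Delta * (1 - exp (- mu * T)) / mu).
    { apply (norm_RInt_le k (fun s => exp (- mu * (t - s)) * (K * L * Delta)) (t - T) t);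
        [lra| |exact Hk|apply minus_integral_bound].
      intros s Hs. unfold k. rewrite Rmax_right by lra.
      apply Rle_trans with (exp (- mu * (t - s)) * norm (Q (g s))).
      - apply SV_decay; [lra|]. rewrite HQ. apply minus_space_invariant; auto. lra.
      - apply Rmult_le_compat_l; [apply Rlt_le, exp_pos|].
        apply Rle_trans with (norm (g s)); auto. }
    (* A fixed-point relation: [SV T] contracts by [exp (- mu * T)] on the minus space, so the norm
       is at most that of [J] divided by [1 - exp (- mu * T)]. *)
    assert (Heq : SV delta dw = plus (SV T (SV delta dw)) J).
    { apply Hinj. rewrite (linear_plus_eq iota), !HSViota, HJ by (auto; lra).
      rewrite <- (semigroup_plus S HS), Rplus_comm, (semigroup_plus S HS) by lra.
      rewrite <- (linear_plus_eq (S delta)) by auto. now rewrite <- HdwI. }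
    assert (Hdec : norm (SV T (SV delta dw)) <= exp (- mu * T) * norm (SV delta dw)).
    { apply SV_decay; [lra|]. rewrite HSViota by lra.
      apply minus_space_invariant; auto. lra. }
    pose proof (norm_plus_le (SV T (SV delta dw)) J) as Htri. rewrite <- Heq in Htri.
    assert (Hexp : exp (- mu * T) < 1) by (rewrite <- exp_0; apply exp_increasing; nra).
    apply Rmult_le_reg_l with (1 - exp (- mu * T)); [lra|].
    replace ((1 - exp (- mu * T)) * (K * L * Delta / mu))
      with (K * L * Delta * (1 - exp (- mu * T)) / mu) by (field; lra).
    lra. }
  apply le_epsilon. intros eps He.
  destruct (semigroup_right_cont SV HSV dw eps He) as [d [Hd Kd]].
  specialize (Kd (d / 2) ltac:(lra)). specialize (Hdelta (d / 2) ltac:(lra)).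
  pose proof (norm_le_minus dw (SV (d / 2) dw)) as H. rewrite norm_minus_sym in H. lra.
Qed.

(** The projected equation: formally [v' = A v + P F(z)], read in [V]. *)
Let G (t : R) : V := plus (Pp (A (iota (v t)))) (Pp (F (z t))).

(** By commutation [v (t + h)] is the projection of [S h (iota (v t))] plus that of the Duhamel
    integral. The first is expanded by the generator, as [v t] lies in the domain; the second by
    continuity of [F (z s)] at [t]. *)
Lemma plus_right_derivative (t : R) :
  little_o (fun h => minus (minus (v (t + h)) (v t)) (scal h (G t))).
Proof.
  set (I := fun h => minus (iota (z (t + h))) (S h (iota (z t)))).
  assert (HI : little_o (fun h => minus (I h) (scal h (F (z t))))).
  { apply (integral_little_o (fun h s => S (t + h - s) (F (z s))) I (F (z t)) t).
    - intros h Hh.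
      destruct (mild_eq S iota F m_infty p_infty z Hz t (t + h) Logic.I ltac:(lra) Logic.I)
        as [J [HJ E]].
      replace (t + h - t) with h in E by ring.
      replace (I h) with J; auto. unfold I. rewrite E. module_eq.
    - intros eps He. destruct (semigroup_bounded S HS 1) as [C [HC1 HC]].
      destruct (proj1 (continuous_norm_iff _ t) (Fz_continuous t) (eps / 2 / C))
        as [d1 [Hd1 K1]]; [apply Rdiv_lt_0_compat; lra|].
      destruct (semigroup_right_cont S HS (F (z t)) (eps / 2)) as [d2 [Hd2 K2]]; [lra|].
      exists (Rmin 1 (Rmin d1 d2)).
      split; [apply Rmin_glb_lt; [lra|now apply Rmin_glb_lt]|].
      intros h s Hh Hs.
      pose proof (Rmin_l 1 (Rmin d1 d2)). pose proof (Rmin_r 1 (Rmin d1 d2)).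
      pose proof (Rmin_l d1 d2). pose proof (Rmin_r d1 d2).
      specialize (K1 s ltac:(apply Rabs_lt_between; lra)).
      specialize (K2 (t + h - s) ltac:(lra)).
      assert (H3 := HC (t + h - s) (minus (F (z s)) (F (z t))) ltac:(lra)).
      rewrite (linear_minus_eq (S (t + h - s))) in H3
        by (apply (semigroup_linear S HS); lra).
      apply Rmult_lt_compat_l with (r := C) in K1; [|lra].
      replace (C * (eps / 2 / C)) with (eps / 2) in K1 by (field; lra).
      apply Rle_trans with (1 := norm_minus_le_trans _ (S (t + h - s) (F (z t))) _).
      lra. }
  assert (HvXp : Xp (iota (v t))) by apply HP.
  assert (HvP : iota (v t) = P (iota (z t))) by reflexivity.
  apply little_o_ext with (fun h =>
    plus (Pp (minus (minus (S h (iota (v t))) (iota (v t))) (scal h (A (iota (v t))))))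
         (Pp (minus (I h) (scal h (F (z t)))))).
  - intros h Hh. rewrite !(linear_minus_eq Pp), !(linear_scal_eq Pp) by auto.
    rewrite (projections_plus_space iota Xm Xp Pm Pp Hinj Hsum HP (v t) HvXp).
    assert (Hv : v (t + h) = plus (Pp (S h (iota (v t)))) (Pp (I h))).
    { rewrite HvP, <- P_commute by lra. unfold P.
      rewrite (projections_plus_space iota Xm Xp Pm Pp Hinj Hsum HP) by apply HP.
      rewrite <- (linear_plus_eq Pp) by auto. unfold v, I. f_equal. module_eq. }
    rewrite Hv. unfold G. module_eq.
  - apply little_o_plus.
    + apply little_o_linear; auto. apply (generator_little_o S D A HA).
      now apply (D_plus_dom D A iota M mu Xp Hplus).
    + now apply little_o_linear.
Qed.

Lemma v_continuous (t : R) : continuous v t.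
Proof.
  apply (continuous_comp z (fun y => Pp (iota y))); [apply z_continuous|].
  apply (continuous_comp iota Pp); now apply linear_continuous.
Qed.

(** The plus space is invariant under [A], so [Pp] fixes the term in [A] and the factor [K] appears
    only in the nonlinear one. *)
Lemma G_difference (a b : R) :
  norm (minus (G a) (G b)) <=
  mu * M * norm (minus (v a) (v b)) + K * L * norm (minus (z a) (z b)).
Proof.
  assert (Hva : Xp (iota (v a))) by apply HP.
  assert (Hvb : Xp (iota (v b))) by apply HP.
  assert (Hv : Xp (iota (minus (v a) (v b)))).
  { rewrite (linear_minus_eq iota) by auto.
    apply subspace_minus; auto. apply (direct_sum_p Xm Xp Hsum). }
  assert (HDom := D_plus_dom D A iota M mu Xp Hplus).
  destruct (generator_minus S D A HS HA _ _ (HDom _ Hva) (HDom _ Hvb)) as [_ HA'].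
  rewrite <- (linear_minus_eq iota) in HA' by auto.
  replace (minus (G a) (G b)) with
    (plus (Pp (A (iota (minus (v a) (v b))))) (Pp (minus (F (z a)) (F (z b))))).
  2:{ rewrite HA', !(linear_minus_eq Pp) by auto. unfold G. module_eq. }
  apply Rle_trans with (1 := norm_plus_le _ _). apply Rplus_le_compat.
  - destruct (D_plus_bound D A iota M mu Xp Hplus _ Hv) as [u [Hu Hn]].
    rewrite <- Hu, (projections_plus_space iota Xm Xp Pm Pp Hinj Hsum HP); auto.
    rewrite Hu. now apply (D_plus_inv D A iota M mu Xp Hplus).
  - apply Rle_trans with (1 := HKp _). rewrite Rmult_assoc.
    apply Rmult_le_compat_l; auto.
Qed.

(* [v] is periodic, so its right derivative [G] has mean zero over a period and is
   therefore bounded by its own oscillation. *)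
Lemma plus_estimate (gamma : R) :
  (forall a b, norm (minus (G a) (G b)) <= gamma) ->
  forall a b, norm (minus (v a) (v b)) <= gamma * T.
Proof.
  intros Hgamma.
  assert (Hgamma0 : 0 <= gamma) by (apply Rle_trans with (2 := Hgamma 0 0); apply norm_ge_0).
  assert (Hvper : forall t, v (t + T) = v t) by (intros t; unfold v; now rewrite Hper).
  assert (HG : forall t, norm (G t) <= gamma).
  { intros t.
    (* The function [v s - s G t] has right derivative [G s - G t], of norm at most [gamma]. Over a
       period [v] cancels and [T * norm (G t)] remains. *)
    assert (H : norm (minus (minus (v T) (scal T (G t))) (minus (v 0) (scal 0 (G t))))
                <= gamma * (T - 0)).
    { apply (right_mean_value (fun s => minus (v s) (scal s (G t)))); [lra| |].
      - intros s _. apply (continuous_minus (V := V)); [apply v_continuous|].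
        apply (continuous_scal_l (V := V) (fun s => s)). apply continuous_id.
      - intros s _ eps He. destruct (plus_right_derivative s eps He) as [d [Hd Kd]].
        exists d. split; auto. intros h Hh. specialize (Kd h Hh).
        replace (minus (minus (v (s + h)) (scal (s + h) (G t))) (minus (v s) (scal s (G t))))
          with (plus (minus (minus (v (s + h)) (v s)) (scal h (G s)))
                     (scal h (minus (G s) (G t)))) by module_eq.
        apply Rle_trans with (1 := norm_plus_le _ _).
        rewrite norm_scal_eq, (Rabs_pos_eq h) by lra.
        specialize (Hgamma s t). nra. }
    replace (v T) with (v 0) in H by (rewrite <- (Hvper 0); f_equal; ring).
    replace (minus (minus (v 0) (scal T (G t))) (minus (v 0) (scal 0 (G t))))
      with (scal (- T) (G t)) in H by module_eq.
    rewrite norm_scal_eq, Rabs_Ropp, Rabs_pos_eq in H by lra.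
    apply Rmult_le_reg_l with T; lra. }
  intros a b. destruct (periodic_representative v T HT Hvper b a) as [a' [Ha' <-]].
  apply Rle_trans with (gamma * (a' - b)); [|apply Rmult_le_compat_l; lra].
  apply right_mean_value; [lra|intros s _; apply v_continuous|].
  intros s _ eps He. destruct (plus_right_derivative s eps He) as [d [Hd Kd]].
  exists d. split; auto. intros h Hh. specialize (Kd h Hh).
  replace (minus (v (s + h)) (v s))
    with (plus (minus (minus (v (s + h)) (v s)) (scal h (G s))) (scal h (G s))) by module_eq.
  apply Rle_trans with (1 := norm_plus_le _ _).
  rewrite norm_scal_eq, (Rabs_pos_eq h) by lra.
  specialize (HG s). nra.
Qed.

(** The condition [K * L < mu] allows the oscillation of [w] to be absorbed into [Delta].
    Nonconstancy gives [Delta > 0], hence [sigma > 0], and the last inequality is divided by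
    [sigma]. *)
Lemma period_lower_bound :
  K * L < mu -> (exists t1 t2, z t1 <> z t2) ->
  1 <= T * (mu * M + K * L / (1 - K * L / mu)).
Proof.
  intros HKL [t1 [t2 Hne]].
  destruct (periodic_oscillation z T HT Hper z_continuous) as [B HB].
  destruct (oscillation_sup z B HB) as [Delta [HDelta HDelta_le]].
  assert (Hvper : forall t, v (t + T) = v t) by (intros t; unfold v; now rewrite Hper).
  destruct (periodic_oscillation v T HT Hvper v_continuous) as [B' HB'].
  destruct (oscillation_sup v B' HB') as [sigma [Hsigma Hsigma_le]].
  assert (HDelta0 : 0 < Delta).
  { apply Rnot_le_lt. intros H. apply Hne, minus_eq_zero_norm.
    apply Rle_trans with (2 := H). apply HDelta. }
  assert (H1 : Delta <= sigma + K * L * Delta / mu).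
  { apply HDelta_le. intros t s.
    replace (minus (z t) (z s)) with (plus (minus (v t) (v s)) (minus (w t) (w s)))
      by (unfold w; module_eq).
    apply Rle_trans with (1 := norm_plus_le _ _).
    apply Rplus_le_compat; auto. now apply minus_estimate. }
  assert (Hk : 0 < 1 - K * L / mu).
  { apply Rmult_lt_reg_r with mu; auto. field_simplify; lra. }
  assert (H1' : Delta <= sigma / (1 - K * L / mu)).
  { apply Rmult_le_reg_r with (1 - K * L / mu); auto.
    replace (sigma / (1 - K * L / mu) * (1 - K * L / mu)) with sigma by (field; lra).
    replace (Delta * (1 - K * L / mu)) with (Delta - K * L * Delta / mu) by (field; lra).
    lra. }
  assert (Hsigma0 : 0 < sigma).
  { apply Rmult_lt_reg_r with (/ (1 - K * L / mu)); [now apply Rinv_0_lt_compat|].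
    unfold Rdiv in H1'. lra. }
  assert (H2 : sigma <= (mu * M * sigma + K * L * Delta) * T).
  { apply Hsigma_le. apply plus_estimate. intros a b.
    apply Rle_trans with (1 := G_difference a b).
    apply Rplus_le_compat; apply Rmult_le_compat_l; auto.
    - apply Rlt_le, Rmult_lt_0_compat; auto.
    - apply Rmult_le_pos; lra. }
  apply Rmult_le_reg_l with sigma; auto.
  replace (sigma * 1) with sigma by ring. apply Rle_trans with (1 := H2).
  replace (sigma * (T * (mu * M + K * L / (1 - K * L / mu))))
    with ((mu * M * sigma + K * L * (sigma / (1 - K * L / mu))) * T) by (field; lra).
  apply Rmult_le_compat_r; [lra|]. apply Rplus_le_compat_l.
  apply Rmult_le_compat_l; auto. apply Rmult_le_pos; lra.
Qed.

End FixedDecomposition.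

(** * The lower bound on the period *)

Theorem corollary2
  (X V : CompleteNormedModule R_AbsRing)
  (S : R -> X -> X) (D : X -> Prop) (A : X -> X) (iota : V -> X)
  (mu0 M L : R) (Xm Xp : R -> X -> Prop)
  (Pm : R -> X -> X) (Pp : R -> X -> V) (F : V -> X)
  (HS : C0_semigroup S)
  (HA : is_generator S D A)
  (HV : V_conditions S D iota)
  (Hmu0 : 0 < mu0)
  (HUHBD : UHBD S D A iota mu0 M (fun _ => 1) Xm Xp)
  (HP : forall mu, mu0 < mu ->
     are_projections iota (Xm mu) (Xp mu) (Pm mu) (Pp mu))
  (HKm : forall mu, mu0 < mu -> Rbar_le (op_norm (Pm mu)) (/ (1 - mu0 / mu)))
  (HKp : forall mu, mu0 < mu -> Rbar_le (op_norm (Pp mu)) (/ (1 - mu0 / mu)))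
  (HL : 0 < L)
  (HF : lipschitz F L)
  (z : R -> V) (T : R)
  (Hz : mild_solution S iota F m_infty p_infty z)
  (HT : 0 < T)
  (Hper : forall t, z (t + T) = z t)
  (Hnonconst : exists t1 t2, z t1 <> z t2) :
  T >= 1 / (L * (1 + sqrt (M * (1 + mu0 / L))) ^ 2).
Proof.
  assert (HM : 0 < M) by exact (UHBD_M _ _ _ _ _ _ _ _ _ HUHBD).
  assert (Hrad : 0 < M * (1 + mu0 / L)).
  { apply Rmult_lt_0_compat; auto. pose proof (Rdiv_lt_0_compat _ _ Hmu0 HL). lra. }
  set (s := sqrt (M * (1 + mu0 / L))).
  assert (Hs : 0 < s) by now apply sqrt_lt_R0.
  assert (Hs2 : L * s ^ 2 = M * (mu0 + L)).
  { unfold s. rewrite pow2_sqrt by lra. field. lra. }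
  (* [mu] minimises the bound [mu * M + K * L / (1 - K * L / mu)] of [period_lower_bound],
     where [K = mu / (mu - mu0)]. *)
  set (x := L * s / M).
  assert (Hx : 0 < x) by (apply Rdiv_lt_0_compat; auto; now apply Rmult_lt_0_compat).
  set (mu := mu0 + L + x).
  assert (Hmu : mu0 < mu) by (unfold mu; lra).
  set (K := / (1 - mu0 / mu)).
  assert (HK : K = mu / (L + x)) by (unfold K, mu; field; lra).
  assert (HK0 : 0 <= K) by (rewrite HK; apply Rlt_le, Rdiv_lt_0_compat; lra).
  assert (HKL : 1 - K * L / mu = x / (L + x)) by (rewrite HK; field; lra).
  assert (HKLmu : K * L < mu).
  { apply Rmult_lt_reg_r with (L + x); [lra|].
    replace (K * L * (L + x)) with (mu * L) by (rewrite HK; field; lra). nra. }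
  destruct HV as [Hinj _ Hiota Hsmooth [SV [HSViota HSV]]].
  destruct (projections_linear iota (Xm mu) (Xp mu) (Pm mu) (Pp mu) Hinj Hiota
              (UHBD_sum _ _ _ _ _ _ _ _ _ HUHBD mu Hmu) (HP mu Hmu) K
              (HKm mu Hmu) (HKp mu Hmu)) as [HKm' [HKp' [HPm HPp]]].
  assert (Hmain := period_lower_bound S D A iota SV (Xm mu) (Xp mu) (Pm mu) (Pp mu)
    M L K mu T F z HS HA Hinj Hiota Hsmooth HSViota HSV ltac:(lra) HM
    (UHBD_sum _ _ _ _ _ _ _ _ _ HUHBD mu Hmu)
    (UHBD_plus _ _ _ _ _ _ _ _ _ HUHBD mu Hmu)
    (UHBD_minus _ _ _ _ _ _ _ _ _ HUHBD mu Hmu)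
    (HP mu Hmu) HPm HPp HKm' HKp' HK0 HL HF Hz HT Hper HKLmu Hnonconst).
  rewrite HKL in Hmain.
  (* The left side is [(mu0 + L + x) * (M + L / x)]. At this [x] the terms [M * x] and
     [L * (mu0 + L) / x] both equal [L * s], and the rest is [L * s ^ 2 + L]. *)
  assert (Hc : mu * M + K * L / (x / (L + x)) = L * (1 + s) ^ 2).
  { assert (Hmu0L : mu0 + L = L * s ^ 2 / M) by (rewrite Hs2; field; lra).
    rewrite HK. unfold mu. rewrite Hmu0L. unfold x. field.
    assert (0 < L * M + L * s) by (apply Rplus_lt_0_compat; now apply Rmult_lt_0_compat).
    repeat split; lra. }
  rewrite Hc in Hmain.
  assert (Hpos : 0 < L * (1 + s) ^ 2) by (apply Rmult_lt_0_compat; auto; apply pow_lt; lra).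
  apply Rle_ge. apply Rmult_le_reg_r with (L * (1 + s) ^ 2); auto.
  replace (1 / (L * (1 + s) ^ 2) * (L * (1 + s) ^ 2)) with 1 by (field; lra).
  exact Hmain.
Qed.
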